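(* Let $D$ be a chord diagram, $a$ a chord of $D$, and $b_1,\dots,b_m$ all the chords of $D$ intersecting $a$. Then \[ W(D)=c\,W(D_a)-y\sum_{i}W(D_{a,i})+y\sum_{i<j}\Big(W(D^{+-}_{a,ij})+W(D^{-+}_{a,ij})-W(D^{l}_{a,ij})-W(D^{r}_{a,ij})\Big), \] where $y=-h^2$. Since every diagram on the right has fewer chords than $D$, this together with $W(\emptyset)=1$ determines $W$ on all chord diagrams.
   Context: Let $\mathfrak g=gl(1|1)$ be the Lie superalgebra with homogeneous basis $H,G$ (even) and $Q_+,Q_-$ (odd) (the matrices $H=I$, $G=\mathrm{diag}(0,1)$, $Q_+=E_{21}$, $Q_-=E_{12}$ acting on $\mathbb C^{1|1}$), whose nonzero supercommutators of basis elements are $[G,Q_\pm]=\pm Q_\pm$, $[Q_+,Q_-]=H$ and those obtained from these by super-antisymmetry. Equip $\mathfrak g$ with the even, supersymmetric, invariant, nondegenerate bilinear form with $\langle Q_+,Q_-\rangle=1=-\langle Q_-,Q_+\rangle$, $\langle H,G\rangle=\langle G,H\rangle=1$ and all other pairings of basis elements zero. Write $\{e_i\}$ for this basis and $(C^{ij})$ for the inverse of the Gram matrix $(\langle e_i,e_j\rangle)$, so that the Casimir tensor is $C=\sum_{i,j}C^{ij}e_i\otimes e_j=G\otimes H+H\otimes G+Q_-\otimes Q_+-Q_+\otimes Q_-$. Let $U=U(\mathfrak g)$ be the universal enveloping superalgebra, $h\in U$ the image of $H$, and $c=\sum C^{ij}e_ie_j\in U$. The centre of $U$ is the polynomial algebra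 $\mathbb C[h,c]$. Put $y=-h^2$. A chord diagram of order $n$ is an oriented circle together with $n$ pairwise disjoint unordered pairs of distinct points on it (chords), considered up to orientation-preserving diffeomorphism of the circle. The universal $gl(1|1)$ weight system $W$ is defined as follows: cut the circle at a point that is not an endpoint, number the $2n$ endpoints $1,\dots,2n$ following the orientation, and let the $k$-th chord have endpoints $p_k<q_k$. Then $W(D)=\sum \big(\prod_{k}C^{i_kj_k}\big)\,\epsilon\,x_1x_2\cdots x_{2n}\in U$, summed over all indices $i_1,j_1,\dots,i_n,j_n$, where $x_{p_k}=e_{i_k}$, $x_{q_k}=e_{j_k}$, and $\epsilon=\pm1$ is the Koszul sign (a factor $-1$ for each transposition of two odd elements) of the rearrangement of $e_{i_1}e_{j_1}e_{i_2}e_{j_2}\cdots e_{i_n}e_{j_n}$ into $x_1\cdots x_{2n}$. $W(D)$ is independent of the cut point and lies in $\mathbb C[h,c]$; $W$ of the diagram with no chords is $1$. Notation for the recursion: for a chord $a$ of $D$, the endpoints of $a$ divide the circle into two open arcs, called the left arc and the right arc. A chord $b$ intersects $a$ if its endpoints separate the endpoints of $a$; then $b$ has one endpoint (its left end) on the left arc and one (its right end) on the right arc. With $b_1,\dots,b_m$ the chords intersecting $a$: $D_a=D\setminus\{a\}$, $D_{a,i}=D\setminus\{a,b_i\}$, $D_{a,ij}=D\setminus\{a,b_i,b_j\}$; $D^{+-}_{a,ij}$ (resp. $D^{-+}_{a,ij}$, $D^{l}_{a,ij}$, $D^{r}_{a,ij}$) is $D_{a,ij}$ with one new chord added joining the left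 end of $b_i$ and the right end of $b_j$ (resp. the right end of $b_i$ and the left end of $b_j$; the left ends of $b_i$ and $b_j$; the right ends of $b_i$ and $b_j$). *)

(* Defs.v *)
From mathcomp Require Import all_boot all_algebra.
From mathcomp Require Import complex Rstruct.
Set Implicit Arguments. Unset Strict Implicit. Unset Printing Implicit Defensive.
Import GRing.Theory.
Local Open Scope ring_scope.

Definition CC : fieldType := (Rdefinitions.R)[i].

(* gl(1|1): basis e_0 = H, e_1 = G (even), e_2 = Q_+, e_3 = Q_- (odd). *)
Definition odd_idx (i : 'I_4) : bool := (2 <= i)%N.

Definition gram_entry (i j : 'I_4) : int :=
  match nat_of_ord i, nat_of_ord j with
  | 0%N, 1%N => 1 | 1%N, 0%N => 1 | 2%N, 3%N => 1 | 3%N, 2%N => -1 | _, _ => 0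
  end.
Definition gram : 'M[CC]_4 := \matrix_(i, j) (gram_entry i j)%:~R.

(* C^{ij}: entries of the inverse Gram matrix, i.e. the coefficients of
   C = G (x) H + H (x) G + Q_- (x) Q_+ - Q_+ (x) Q_-. *)
Definition Cc (i j : 'I_4) : int :=
  match nat_of_ord i, nat_of_ord j with
  | 1%N, 0%N => 1 | 0%N, 1%N => 1 | 3%N, 2%N => 1 | 2%N, 3%N => -1 | _, _ => 0
  end.
Definition Cmx : 'M[CC]_4 := \matrix_(i, j) (Cc i j)%:~R.

(* U(gl(1|1)) is described by its universal property: an (associative,
   unital) CC-algebra A together with images H G Qp Qm of the basis
   satisfying the defining relations x y - (-1)^{|x||y|} y x = [x,y]
   for all pairs of basis elements.  Equality in U is equality in every
   such A. *)
Definition gl11_rel (A : algType CC) (H G Qp Qm : A) : Prop :=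
  [/\ H * G - G * H = 0, H * Qp - Qp * H = 0, H * Qm - Qm * H = 0,
      G * Qp - Qp * G = Qp & G * Qm - Qm * G = - Qm] /\
  [/\ Qp * Qm + Qm * Qp = H, Qm * Qp + Qp * Qm = H,
      Qp * Qp + Qp * Qp = 0 & Qm * Qm + Qm * Qm = 0].

Definition gen (A : algType CC) (H G Qp Qm : A) (i : 'I_4) : A :=
  nth 0 [:: H; G; Qp; Qm] i.

Definition casimir (A : algType CC) (e : 'I_4 -> A) : A :=
  \sum_(i < 4) \sum_(j < 4) (Cc i j)%:~R * (e i * e j).

(* Chord diagrams, cut at a point: a word D of chord labels (nat), the
   2n endpoints listed in the order of the orientation, each label
   occurring exactly twice (the two endpoints of that chord). *)
Definition chord_diagram (D : seq nat) : bool :=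
  all (fun x => count_mem x D == 2%N) D.

Definition pos1 (D : seq nat) (x : nat) : nat := index x D.
Definition pos2 (D : seq nat) (x : nat) : nat :=
  ((index x D).+1 + index x (drop (index x D).+1 D))%N.

(* position k lies on the "left arc" of chord a: strictly between its ends
   (the other open arc, passing through the cut, is the "right arc"). *)
Definition on_left (D : seq nat) (a k : nat) : bool :=
  (pos1 D a < k < pos2 D a)%N.

Definition crosses (D : seq nat) (a b : nat) : bool :=
  (b != a) &&
  (count (fun k => (nth 0%N D k == b) && on_left D a k) (iota 0 (size D)) == 1%N).

Definition crossing (D : seq nat) (a : nat) : seq nat :=
  [seq b <- undup D | crosses D a b].

Definition del (D : seq nat) (s : seq nat) : seq nat :=
  [seq x <- D | x \notin s].

Definition fresh (D : seq nat) : nat := (foldr maxn 0%N D).+1.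

(* D_{a,ij} with a new chord joining the end of b_i on the left (li = true)
   / right (li = false) arc of a and the end of b_j on the left (lj = true)
   / right (lj = false) arc of a. *)
Definition join (D : seq nat) (a bi bj : nat) (li lj : bool) : seq nat :=
  pmap (fun kx : nat * nat =>
          let: (k, x) := kx in
          if x == a then None
          else if x == bi then (if on_left D a k == li then Some (fresh D) else None)
          else if x == bj then (if on_left D a k == lj then Some (fresh D) else None)
          else Some x)
       (zip (iota 0 (size D)) D).

(* The universal gl(1|1) weight system, evaluated in A.
   Chords are numbered 0..n-1 in order of their first endpoint (undup D);
   f assigns to chord c its pair of indices (i_c, j_c); the first endpoint
   p_c gets e_{i_c}, the second q_c gets e_{j_c}.  The Koszul sign counts
   the pairs of odd letters whose relative order differs between the
   reference word e_{i_0} e_{j_0} e_{i_1} e_{j_1} ... and x_1 ... x_{2n}. *)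
Definition W (A : algType CC) (e : 'I_4 -> A) (D : seq nat) : A :=
  let L := undup D in
  \sum_(f : {ffun 'I_(size L) -> 'I_4 * 'I_4})
    let s c := odflt (ord0, ord0) (omap f (insub c)) in
    let chord k := index (nth 0%N D k) L in
    let second k := index (nth 0%N D k) D != k in
    let x k := if second k then (s (chord k)).2 else (s (chord k)).1 in
    let ref k := ((chord k).*2 + second k)%N in
    (\prod_(c < size L) (Cc (f c).1 (f c).2)%:~R) *
    ((-1) ^+ (\sum_(k < size D) \sum_(l < size D |
          [&& (k < l)%N, odd_idx (x k), odd_idx (x l) & (ref l < ref k)%N]) 1%N)) *
    \prod_(k < size D) e (x k).

(* Main.v *)
Require Import Defs.
From mathcomp Require Import all_boot all_algebra.
From mathcomp Require Import complex Rstruct.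
From Stdlib Require Import FunctionalExtensionality.
Set Implicit Arguments. Unset Strict Implicit. Unset Printing Implicit Defensive.
Import GRing.Theory.
Local Open Scope ring_scope.

(** Move the right end of the chord [a] leftwards through the arc between its
    two ends until both ends are adjacent; the word then equals [c] times the
    word of [D_a].  Since [H] is central, passing the end [t] of another chord,
    with opposite end [t'], produces [H] times words in which one chord carries
    only the antisymmetric tensor Omega(x,y) = Q-(x)Q+(y) - Q-(y)Q+(x), in the
    combination Omega(t,t') + Omega(p,t) - Omega(p,t'), [p] being the left end of
    [a].  Moving the letter at [p] up to [t] in the same way yields a second
    factor [H], the diagram without [a] and the chord of [t] (from the relation
    [Q+,Q-] = H), and a sum over the ends [s] passed on the way of
    kappa(s,t) = K(s,t) - K(s',t) - K(s,t') + K(s',t'), where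
    K(x,y) = Q-(x)Q+(y) + Q-(y)Q+(x) is the odd part of a chord from x to y.
    Now kappa is symmetric and odd under s <-> s', so the chords with both ends on
    the arc cancel, and in the four-term combination of the statement the even
    part of the new chord, [H] times a sum of one-point insertions of [G],
    cancels as well. *)

(** * Koszul signs *)

(** The Casimir tensor pairs each basis element with its dual only, so one letter per chord
    describes a summand; it is even and supersymmetric, so neither the numbering of the chords nor
    the choice of a first end matters. The intermediate words are not diagrams: the label [a] marks
    a fixed pair of odd letters, while the other chord involved leaves the word. The second [H]
    arises when the letter at p reaches t: Omega(p,t) becomes the difference of the two orders of
    adjacent Q- and Q+, which is [H], and -Omega(p,t') becomes -Omega(t,t'), cancelling the first
    tensor. If t' is passed on the way, the two letters meet there and twice this [H] is subtracted;
    the diagram without the chord of t then enters negatively and cancels what the end t'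
    contributed. Ends are passed in the order of the arc, so the pairs come with s before t, while
    the formula lists the crossing chords in another order. The sum over ordered pairs sees neither
    order, and halving it is possible over the complex numbers. *)

Local Notation tok := (nat * bool)%type.

Definition flip (t : tok) : tok := (t.1, ~~ t.2).
(* Rank of an end in the reference word e_{i_0} e_{j_0} e_{i_1} e_{j_1} ... *)
Definition key (t : tok) : nat := (t.1.*2 + t.2)%N.

Fixpoint inversions (s : seq nat) : nat :=
  if s is x :: s' then (count (fun y => y < x)%N s' + inversions s')%N else 0%N.

(** Meant for the sublist of ends with odd letters, since only transpositions of two odd letters
    change the sign. *)
Definition koszul (s : seq tok) : bool := odd (inversions (map key s)).

Definition labels (w : seq tok) : seq nat := map fst w.

Lemma flipK : involutive flip.
Proof. by case=> n b; rewrite /flip /= negbK. Qed.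

Lemma flip_neq t : (flip t == t) = false.
Proof. by case: t => n b; rewrite /flip xpair_eqE eqxx; case: b. Qed.

Lemma tok_label_eq (t x : tok) : x.1 = t.1 -> (x = t) \/ (x = flip t).
Proof. by case: t x => n [] [m []] /= ->; rewrite /flip /=; auto. Qed.

Lemma key_inj : injective key.
Proof.
case=> n b [m c]; rewrite /key /= => /eqP E.
have Ebc : b = c.
  by have /(congr1 odd) := eqP E; rewrite !oddD !odd_double /=; case: b c {E} => [] [].
by move: E; rewrite Ebc eqn_add2r -!muln2 eqn_mul2r /= => /eqP ->.
Qed.

Lemma labelsP n w : reflect (exists b, (n, b) \in w) (n \in labels w).
Proof.
apply: (iffP mapP) => [[[m b] H /= ->]|[b H]]; first by exists b.
by exists (n, b).
Qed.

Lemma koszul_cons x s : koszul (x :: s) = odd (count (fun y => key y < key x)%N s) (+) koszul s.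
Proof. by rewrite /koszul /= oddD count_map. Qed.

Lemma koszul_swap al be x y : x != y ->
  koszul (al ++ x :: y :: be) = ~~ koszul (al ++ y :: x :: be).
Proof.
move=> xy; elim: al => [|z al IH] /=.
  rewrite !koszul_cons /= !oddD !oddb.
  have : (key y < key x)%N = ~~ (key x < key y)%N.
    by rewrite -leqNgt ltn_neqAle (inj_eq key_inj) eq_sym xy.
  by move=> ->; case: (_ < _)%N; case: (odd _); case: (odd _); case: (koszul be).
rewrite !koszul_cons IH !count_cat /=.
by rewrite [X in (_ + X)%N]addnCA addbN.
Qed.

Lemma koszul_move al x be ga : x \notin be ->
  koszul (al ++ x :: be ++ ga) = odd (size be) (+) koszul (al ++ be ++ x :: ga).
Proof.
elim: be al => [|z be IH] al //=.
rewrite inE negb_or => /andP[xz xbe].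
rewrite (koszul_swap _ _ xz) -cat_rcons IH // cat_rcons.
by rewrite addNb.
Qed.

(** Both tokens travel past [be], so its length counts twice and a single transposition remains. *)
Lemma koszul_exchange al x be y ga : x \notin be -> y \notin be -> x != y ->
  koszul (al ++ x :: be ++ y :: ga) = ~~ koszul (al ++ y :: be ++ x :: ga).
Proof.
move=> xbe ybe xy.
rewrite koszul_move // (koszul_move _ _ ybe) catA koszul_swap // -catA.
by rewrite addbN.
Qed.

(** The two keys are consecutive integers, so any other key compares equally with both and its
    inversions with them come in pairs. *)
Lemma koszul_pair_adj al n be : n \notin labels al -> n \notin labels be ->
  koszul (al ++ (n, false) :: (n, true) :: be) = koszul (al ++ be).
Proof.
have kE m c : (m != n) -> (key (m, c) < key (n, true))%N = (key (m, c) < key (n, false))%N.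
  move=> mn; rewrite /key /= addn0 addn1 ltnS leq_eqVlt orb_idl // => /eqP E.
  have /(congr1 odd) := E; rewrite oddD !odd_double /= => /eqP.
  case: c E => //= /eqP; rewrite addn0 -!muln2 eqn_mul2r /= => E.
  by rewrite E in mn.
have kE' m c : (m != n) -> (key (n, true) < key (m, c))%N = (key (n, false) < key (m, c))%N.
  move=> mn; rewrite !ltnNge; congr negb.
  rewrite (leq_eqVlt _ (key (n, true))) (leq_eqVlt _ (key (n, false))) kE //.
  by rewrite !(inj_eq key_inj) !xpair_eqE (negPf mn).
elim: al => [_ nbe|[m c] al IH].
  rewrite !koszul_cons /=.
  rewrite (_ : (key (n, true) < key (n, false))%N = false); last first.
    by rewrite /key /= addn0 addn1 ltnNge leqnSn.
  rewrite add0n; rewrite (@eq_in_count _ _ (fun y => key y < key (n, true))%N); first by rewrite addbA addbb.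
  move=> [m c] ybe /=; rewrite kE //; apply: contraNneq nbe => <-.
  by apply/labelsP; exists c.
rewrite /= inE negb_or eq_sym => /andP[mn nal] nbe.
rewrite !koszul_cons IH // !count_cat /= kE' //.
rewrite !oddD !oddb; case: (_ < _)%N; case: (odd _); case: (odd _); by case: (koszul _).
Qed.

(** The left end is slid across [be] to its partner; the flag [b] records whether the adjacent pair
    is then in the wrong order. *)
Lemma koszul_pair al n b be ga :
  n \notin labels al -> n \notin labels be -> n \notin labels ga ->
  koszul (al ++ (n, b) :: be ++ (n, ~~ b) :: ga) =
  b (+) odd (size be) (+) koszul (al ++ be ++ ga).
Proof.
move=> nal nbe nga.
have nb c : (n, c) \notin be by apply: contra nbe => H; apply/labelsP; exists c.
rewrite koszul_move // catA.
have nabe : n \notin labels (al ++ be) by rewrite /labels map_cat mem_cat negb_or nal.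
case: b => /=.
  rewrite koszul_swap ?xpair_eqE ?andbF //. rewrite koszul_pair_adj // -catA.
  by rewrite addbN addNb.
by rewrite koszul_pair_adj // -catA.
Qed.

Definition valid (w : seq tok) := uniq w && all (fun t => flip t \in w) w.

Lemma valid_split t w : valid w -> t \in w ->
  exists c al be ga, [/\ w = al ++ (t.1, c) :: be ++ (t.1, ~~ c) :: ga,
     t.1 \notin labels al, t.1 \notin labels be, t.1 \notin labels ga & valid (al ++ be ++ ga)].
Proof.
case: t => n b /= /andP[uw /allP fw] tw.
have {b tw}[c [al [ga [wE nal]]]] : exists c al ga, w = al ++ (n, c) :: ga /\ n \notin labels al.
  elim: w tw {uw fw} => [|[m d] w IH] //; rewrite inE => tw.
  have [->|nm] := eqVneq m n; first by exists d, [::], w.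
  move: tw; rewrite xpair_eqE eq_sym (negPf nm) /= => /IH[c [al [ga [-> nal]]]].
  exists c, ((m, d) :: al), ga; split => //.
  by rewrite /= inE negb_or eq_sym nm.
have : (n, ~~ c) \in ga.
  have : (n, c) \in w by rewrite wE mem_cat inE eqxx orbT.
  move/fw; rewrite /flip /= wE mem_cat inE xpair_eqE eqxx /=.
  have -> : (~~ c == c) = false by case: (c).
  by case/orP => // H; case/negP: nal; apply/labelsP; exists (~~ c).
move/splitPr => H; case: H wE => be {}ga wE.
exists c, al, be, ga.
have U x : x.1 = n -> [/\ x \notin al, x \notin be & x \notin ga].
  move=> xn; have xal : x \notin al.
    by apply: contra nal => H; apply/labelsP; exists x.2; rewrite -xn -surjective_pairing.
  move: uw; rewrite wE cat_uniq => /and3P[_ _ /= /andP[]].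
  rewrite mem_cat inE !negb_or => /and3P[cb _ cg].
  rewrite cat_uniq /= negb_or => /and3P[_ /andP[cb' _] /andP[cg' _]].
  have : x = (n, c) \/ x = (n, ~~ c) by apply: (@tok_label_eq (n, c)).
  by case=> E; split; rewrite ?{1}E -?E // E.
have N s : (forall x : tok, x.1 = n -> x \notin s) -> n \notin labels s.
  by move=> H; apply/labelsP => -[b]; apply/negP; apply: H.
have V x : x \in al ++ be ++ ga -> x.1 != n.
  apply: contraTneq => /U[xa xb xg].
  by rewrite !mem_cat !negb_or xa xb.
split=> //; try by apply: N => x /U[].
apply/andP; split.
  apply: subseq_uniq uw; rewrite wE.
  by rewrite cat_subseq // (subseq_trans _ (subseq_cons _ _)) // cat_subseq // subseq_cons.
apply/allP => x xin; have := V _ xin => xn.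
have : flip x \in w.
  apply: fw; move: xin; rewrite wE !(mem_cat, inE).
  by case/or3P => ->; rewrite ?orbT.
rewrite wE !(mem_cat, inE) /flip !xpair_eqE (negPf xn) /=.
by [].
Qed.

(* Moving a chord as a whole past other odd letters costs no sign, so the sign
   of a word does not depend on the order in which the chords are numbered. *)
Lemma koszul_relabel (rho : nat -> nat) w : valid w ->
  {in labels w &, injective rho} ->
  koszul [seq (rho t.1, t.2) | t <- w] = koszul w.
Proof.
have [k] := ubnP (size w); elim: k w => // k IH [|t w] // sw vw ir.
have [c [al [be [ga [wE na nb ng v]]]]] := valid_split vw (mem_head t w).
rewrite wE in ir sw *.
have I s : (forall m, m \in labels s -> m \in labels (al ++ (t.1, c) :: be ++ (t.1, ~~ c) :: ga)) ->
    t.1 \notin labels s -> rho t.1 \notin labels [seq (rho x.1, x.2) | x <- s].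
  move=> sub; apply: contra; rewrite /labels -map_comp => /mapP[x xs /= E].
  have xl : x.1 \in labels s by apply: map_f.
  rewrite (_ : t.1 = x.1) //; apply: ir => //; last exact: sub.
  by rewrite /labels map_cat mem_cat /= inE eqxx orbT.
rewrite map_cat /= map_cat /= !koszul_pair //; first last.
- apply: I => // m; rewrite /labels !map_cat /= !map_cat /= !(mem_cat, inE) => ->; by rewrite !orbT.
- apply: I => // m; rewrite /labels !map_cat /= !map_cat /= !(mem_cat, inE) => ->; by rewrite !orbT.
- apply: I => // m; rewrite /labels !map_cat /= !(mem_cat, inE) => ->; by rewrite ?orbT.
rewrite size_map -!map_cat IH //.
  move: sw; rewrite !size_cat /= size_cat /= !addnS !ltnS => H.
  by apply: leq_trans H; rewrite leqnSn.
move=> x y Hx Hy; apply: ir; move: Hx Hy; rewrite /labels !map_cat /= map_cat !(mem_cat, inE) /=.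
  by case/or3P=> ->; rewrite ?orbT.
by move=> _ /or3P[] ->; rewrite ?orbT.
Qed.

(** * Letters, words and their values *)

Definition iH : 'I_4 := @Ordinal 4 0 isT.
Definition iG : 'I_4 := @Ordinal 4 1 isT.
Definition iP : 'I_4 := @Ordinal 4 2 isT.
Definition iM : 'I_4 := @Ordinal 4 3 isT.

Definition dual (i : 'I_4) : 'I_4 :=
  match nat_of_ord i with 0%N => iG | 1%N => iH | 2%N => iM | _ => iP end.

Lemma ord4P (i : 'I_4) : [\/ i = iH, i = iG, i = iP | i = iM].
Proof.
by case: i => [[|[|[|[|]]]] //= p]; [apply: Or41|apply: Or42|apply: Or43|apply: Or44]; apply: val_inj.
Qed.

Lemma sum4 (V : nmodType) (F : 'I_4 -> V) :
  \sum_(i < 4) F i = F iH + F iG + F iP + F iM.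
Proof.
rewrite !big_ord_recl big_ord0 addr0 !addrA.
by congr (F _ + F _ + F _ + F _); apply: val_inj.
Qed.

Lemma dualK : involutive dual.
Proof. by move=> i; case: (ord4P i) => ->. Qed.

Lemma odd_dual i : odd_idx (dual i) = odd_idx i.
Proof. by case: (ord4P i) => ->. Qed.

(** The only nonzero coefficient with first index [i]: it is -1 for [iP] and 1 otherwise. *)
Definition cas_coef (i : 'I_4) : int := Cc i (dual i).

Definition upd (f : nat -> 'I_4) n i : nat -> 'I_4 := fun m => if m == n then i else f m.

Lemma updE f n i : upd f n i n = i.
Proof. by rewrite /upd eqxx. Qed.

Lemma updN f n i m : m != n -> upd f n i m = f m.
Proof. by rewrite /upd => /negPf ->. Qed.

Lemma updC f n i m j : m != n -> upd (upd f n i) m j = upd (upd f m j) n i.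
Proof.
move=> mn; apply: functional_extensionality => k; rewrite /upd.
by case: eqVneq => // ->; rewrite (negPf mn).
Qed.

Lemma upd_upd f n i j : upd (upd f n i) n j = upd f n j.
Proof. by apply: functional_extensionality => k; rewrite /upd; case: eqP. Qed.

(* A token [(n, b)] is an end of chord [n]; the end with flag [false] carries
   the letter [f n], the other one the dual letter. *)
Definition letter (f : nat -> 'I_4) (t : tok) : 'I_4 := if t.2 then dual (f t.1) else f t.1.

Lemma letter_flip f t : letter f (flip t) = dual (letter f t).
Proof. by case: t => n []; rewrite /letter //= dualK. Qed.

Definition oddf f (w : seq tok) := [seq t <- w | odd_idx (letter f t)].

Lemma labels_oddf f n w : n \notin labels w -> n \notin labels (oddf f w).
Proof.
apply: contra => /labelsP[b]; rewrite mem_filter => /andP[_ H].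
by apply/labelsP; exists b.
Qed.

Lemma notin_labels_cat n v w :
  (n \notin labels (v ++ w)) = (n \notin labels v) && (n \notin labels w).
Proof. by rewrite /labels map_cat mem_cat negb_or. Qed.

Lemma notin_labels_cons n x w :
  (n \notin labels (x :: w)) = (n != x.1) && (n \notin labels w).
Proof. by rewrite /= inE negb_or. Qed.

Lemma oddf_cat f v w : oddf f (v ++ w) = oddf f v ++ oddf f w.
Proof. exact: filter_cat. Qed.

Lemma oddf_cons f x w : oddf f (x :: w) = if odd_idx (letter f x) then x :: oddf f w else oddf f w.
Proof. by []. Qed.

Lemma letter_upd f n i (x : tok) : x.1 != n -> letter (upd f n i) x = letter f x.
Proof. by rewrite /letter /upd => /negPf ->. Qed.

Lemma notin_label n (w : seq tok) (x : tok) : n \notin labels w -> x \in w -> x.1 != n.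
Proof. by move=> nw xw; apply: contraNneq nw => <-; apply: map_f. Qed.

Lemma oddf_upd f n i w : n \notin labels w -> oddf (upd f n i) w = oddf f w.
Proof. by move=> nw; apply: eq_in_filter => x xw; rewrite letter_upd // (notin_label nw). Qed.

Definition oseq (o : option tok) : seq tok := if o is Some x then [:: x] else [::].

(* Replaces the two ends of the chord of [t]; [None] deletes an end. *)
Definition sub (t : tok) (o o' : option tok) : seq tok -> seq tok :=
  pmap (fun x => if x == t then o else if x == flip t then o' else Some x).

Lemma sub_cat t o o' v w : sub t o o' (v ++ w) = sub t o o' v ++ sub t o o' w.
Proof. exact: pmap_cat. Qed.

Lemma sub_t t o o' w : sub t o o' (t :: w) = oseq o ++ sub t o o' w.
Proof. by rewrite /= eqxx; case: o. Qed.

Lemma sub_f t o o' w : sub t o o' (flip t :: w) = oseq o' ++ sub t o o' w.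
Proof. by rewrite /= flip_neq eqxx; case: o'. Qed.

Lemma sub_n t o o' x w : x.1 != t.1 -> sub t o o' (x :: w) = x :: sub t o o' w.
Proof.
move=> xt.
have E1 : (x == t) = false by apply: contraNF xt => /eqP ->.
have E2 : (x == flip t) = false by apply: contraNF xt => /eqP ->.
by rewrite /= E1 E2.
Qed.

Lemma sub_id t o o' w : t.1 \notin labels w -> sub t o o' w = w.
Proof.
elim: w => // x w IH; rewrite [labels _]/= inE negb_or => /andP[tx tw].
by rewrite sub_n 1?eq_sym // IH.
Qed.

Lemma sub_flip t o o' w : sub (flip t) o o' w = sub t o' o w.
Proof.
apply: eq_pmap => x; rewrite flipK.
case: (eqVneq x t) => [->|]; last by [].
by rewrite eq_sym flip_neq.
Qed.

(** The partner of an end may lie on either side of it; the sign computations for a moving letter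
    split along these two cases. *)
Lemma split_flip al t be : uniq (al ++ t :: be) -> flip t \in al ++ be ->
  (exists a1 a2, al = a1 ++ flip t :: a2 /\
     [/\ t.1 \notin labels a1, t.1 \notin labels a2 & t.1 \notin labels be]) \/
  (exists b1 b2, be = b1 ++ flip t :: b2 /\
     [/\ t.1 \notin labels al, t.1 \notin labels b1 & t.1 \notin labels b2]).
Proof.
move=> uw; rewrite mem_cat.
have N s : t \notin s -> flip t \notin s -> t.1 \notin labels s.
  move=> ts fs; apply/labelsP => -[b].
  by have [->|->] := @tok_label_eq t (t.1, b) erefl; apply/negP.
have {}uw : uniq (t :: al ++ be) by rewrite -(perm_uniq (permEl (perm_catCA al [:: t] be))).
move: uw => /= /andP[]; rewrite mem_cat negb_or => /andP[ta tb] uw.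
case/orP => /splitPr H; [left|right].
  case: H ta uw => a1 a2; rewrite mem_cat inE !negb_or => /and3P[ta1 _ ta2].
  rewrite -catA /= cat_uniq /= negb_or mem_cat negb_or => /and3P[_ /andP[f1 _] /andP[/andP[f2 f3] _]].
  by exists a1, a2; split=> //; split; apply: N.
case: H tb uw => b1 b2; rewrite mem_cat inE !negb_or => /and3P[tb1 _ tb2].
rewrite catA cat_uniq /= negb_or mem_cat negb_or => /and3P[_ /andP[/andP[f1 f2] _] /andP[f3 _]].
by exists b1, b2; split=> //; split; apply: N.
Qed.

Section Weights.
Variables (A : algType CC) (H G Qp Qm : A).
Hypothesis rel : gl11_rel H G Qp Qm.

Local Notation e := (gen H G Qp Qm).

Definition wprod f (w : seq tok) : A := \prod_(t <- w) e (letter f t).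

Definition term f (w : seq tok) : A := (-1) ^+ koszul (oddf f w) * wprod f w.

Lemma wprod_cat f v w : wprod f (v ++ w) = wprod f v * wprod f w.
Proof. exact: big_cat. Qed.

Lemma wprod_cons f x w : wprod f (x :: w) = e (letter f x) * wprod f w.
Proof. exact: big_cons. Qed.

Lemma wprod_upd f n i w : n \notin labels w -> wprod (upd f n i) w = wprod f w.
Proof.
move=> nw; rewrite /wprod !big_seq; apply: eq_bigr => x xw.
by rewrite letter_upd // (notin_label nw).
Qed.

Lemma commH i : GRing.comm H (e i).
Proof.
case: rel => -[/eqP + /eqP + /eqP + _ _] _; rewrite !subr_eq0 => /eqP HG /eqP HP /eqP HM.
by case: (ord4P i) => ->; rewrite /GRing.comm.
Qed.

Lemma commH_pr f w : GRing.comm H (wprod f w).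
Proof. by apply: commr_prod => t _; apply: commH. Qed.

(** Characteristic zero enters here: it turns the anticommutator relation into [Qp * Qp = 0] and
    later permits halving a sum over ordered pairs. *)
Lemma half0 (x : A) : x + x = 0 -> x = 0.
Proof.
rewrite -mulr2n -scaler_nat => /eqP; rewrite scaler_eq0.
by rewrite (@Num.Theory.pnatr_eq0 (Rdefinitions.R)[i]) /= => /eqP.
Qed.

Definition scom (i j : 'I_4) : A :=
  e i * e j - (-1) ^+ (odd_idx i && odd_idx j) * (e j * e i).

Lemma scomE :
  [/\ scom iP iH = 0, scom iP iG = - Qp, scom iP iP = 0 & scom iP iM = H] /\
  [/\ scom iM iH = 0, scom iM iG = Qm, scom iM iP = H & scom iM iM = 0] /\
  [/\ scom iG iH = 0, scom iG iG = 0, scom iG iP = Qp & scom iG iM = - Qm].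
Proof.
case: rel => -[HG HP HM GP GM] [PM MP PP MM].
have E i j : ~~ (odd_idx i && odd_idx j) -> scom i j = e i * e j - e j * e i.
  by rewrite /scom => /negPf ->; rewrite expr0 mul1r.
have O i j : odd_idx i && odd_idx j -> scom i j = e i * e j + e j * e i.
  by rewrite /scom => ->; rewrite expr1 mulN1r opprK.
split; [|split]; split.
- by rewrite E // -[LHS]opprK opprB HP oppr0.
- by rewrite E // -[LHS]opprK opprB GP.
- by rewrite O.
- by rewrite O.
- by rewrite E // -[LHS]opprK opprB HM oppr0.
- by rewrite E // -[LHS]opprK opprB GM opprK.
- by rewrite O.
- by rewrite O.
- by rewrite E // -[LHS]opprK opprB HG oppr0.
- by rewrite E // subrr.
- by rewrite E.
- by rewrite E.
Qed.

(** The Koszul sign changes exactly when both letters are odd, which turns the commutator of the two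
    letters into their supercommutator. *)
Lemma termB f al x t be : x != t ->
  term f (al ++ x :: t :: be) - term f (al ++ t :: x :: be) =
  (-1) ^+ koszul (oddf f (al ++ x :: t :: be)) * (wprod f al * scom (letter f x) (letter f t) * wprod f be).
Proof.
move=> xt; rewrite /term !wprod_cat !wprod_cons /scom !oddf_cat !oddf_cons.
rewrite mulrBr mulrBl mulrBr !mulrA; congr (_ - _).
have C z : GRing.comm z ((-1) ^+ (odd_idx (letter f x) && odd_idx (letter f t)) : A).
  by apply: commrX; apply: commrN1.
rewrite -(mulrA _ (wprod f al)) C !mulrA; congr (_ * _ * _ * _ * _).
case: (odd_idx (letter f x)); case: (odd_idx (letter f t)) => /=; rewrite ?expr0 ?mul1r //.
rewrite (koszul_swap _ _ xt); case: (koszul _); rewrite /= ?expr0 ?expr1 ?mul1r ?mulN1r ?opprK //.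
Qed.

End Weights.

(** * Moving one letter past one end of a chord *)

Section Moves.
Variables (A : algType CC) (H G Qp Qm : A).
Hypothesis rel : gl11_rel H G Qp Qm.

Local Notation e := (gen H G Qp Qm).
Local Notation wprod := (wprod H G Qp Qm).
Local Notation term := (term H G Qp Qm).
Local Notation scom := (scom H G Qp Qm).

Lemma sign_comm (b : bool) (z : A) : GRing.comm z ((-1) ^+ b).
Proof. by apply: commrX; apply: commrN1. Qed.

Lemma H_term f w : H * term f w = (-1) ^+ koszul (oddf f w) * (H * wprod f w).
Proof. by rewrite /term !mulrA (sign_comm _ H). Qed.

Lemma pullH1 (a1 a2 x b : A) : GRing.comm H a1 ->
  a1 * (H * a2) * x * b = H * (a1 * (a2 * (x * b))).
Proof. by move=> C; rewrite !mulrA C. Qed.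

Lemma pullH2 (a x b1 b2 : A) : GRing.comm H a -> GRing.comm H x -> GRing.comm H b1 ->
  a * x * (b1 * (H * b2)) = H * (a * (x * (b1 * b2))).
Proof. by move=> C1 C2 C3; rewrite !mulrA C1 -(mulrA a H) C2 !mulrA -(mulrA _ H b1) C3 !mulrA. Qed.

Lemma neq_labels (x t : tok) : x.1 != t.1 -> x != t.
Proof. by apply: contraNneq => ->. Qed.

(* The letter [G] at [t] forces the central letter [H] at [flip t], which
   factors out. *)
Lemma term_G f i al x t be : uniq (al ++ t :: be) -> flip t \in al ++ be ->
  x.1 != t.1 -> letter (upd f t.1 i) t = iG ->
  (-1) ^+ koszul (oddf (upd f t.1 i) (al ++ x :: t :: be)) *
    (wprod (upd f t.1 i) al * e (letter f x) * wprod (upd f t.1 i) be) =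
  H * term f (sub t (Some x) None (al ++ t :: be)).
Proof.
move=> uw fw xt tG.
have fH : letter (upd f t.1 i) (flip t) = iH by rewrite letter_flip tG.
rewrite H_term; case: (split_flip uw fw) => -[s1 [s2 [-> [n1 n2 n3]]]].
- rewrite -!catA !cat_cons !(sub_cat, sub_t, sub_f) !sub_id // /oseq !cat0s !cat_cons cat0s.
  rewrite !(oddf_cat, oddf_cons) tG fH /= !oddf_upd // !(wprod_cat, wprod_cons) wprod_upd // fH.
  rewrite letter_upd // !wprod_upd //; congr (_ * _).
  by rewrite pullH1 //; apply: commH_pr rel _ _.
rewrite !(sub_cat, sub_t, sub_f) !sub_id // /oseq !cat0s !cat_cons cat0s.
rewrite !(oddf_cat, oddf_cons) tG fH /= !oddf_upd // !(wprod_cat, wprod_cons) wprod_upd // fH.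
rewrite letter_upd // !wprod_upd //; congr (_ * _).
by rewrite pullH2 //; first [exact: commH_pr rel _ _|exact: commH rel _].
Qed.

Lemma letter_of_flag n f t j (x := upd f n (if t.2 then dual j else j)) : t.1 = n -> letter x t = j.
Proof. by case: t @x => m [] /= <-; rewrite /letter /= updE ?dualK. Qed.

Lemma cas_coef_sign (c : bool) (j : 'I_4) : odd_idx j ->
  cas_coef (if c then dual j else j) = (-1) ^+ (c (+) (j == iP)).
Proof. by case: (ord4P j) => ->; case: c. Qed.

Lemma cas_coef_even (c : bool) (j : 'I_4) : ~~ odd_idx j -> cas_coef (if c then dual j else j) = 1.
Proof. by case: (ord4P j) => ->; case: c. Qed.

Lemma sum_letter (V : nmodType) (c : bool) (X : 'I_4 -> V) :
  \sum_(i < 4) X i = \sum_(j < 4) X (if c then dual j else j).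
Proof. by case: c => //; rewrite (reindex_inj (inv_inj dualK)). Qed.

Lemma signz (b : bool) : ((-1) ^+ b : int)%:~R = (-1) ^+ b :> A.
Proof. by case: b. Qed.

Lemma koszul_flip_adj al t be : t.1 \notin labels al -> t.1 \notin labels be ->
  koszul (al ++ flip t :: t :: be) = ~~ t.2 (+) koszul (al ++ be).
Proof.
case: t => n b na nb.
by rewrite -{2}(negbK b) (@koszul_pair al n (~~ b) [::] be) //= addbF.
Qed.

Lemma koszul_flip_pair al t be ga :
  t.1 \notin labels al -> t.1 \notin labels be -> t.1 \notin labels ga ->
  koszul (al ++ t :: be ++ flip t :: ga) = t.2 (+) odd (size be) (+) koszul (al ++ be ++ ga).
Proof. by case: t => n b; apply: koszul_pair. Qed.

(** Exchanging [x] with [flip t] costs one sign and puts [flip t] directly before [t]; deleting this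
    adjacent pair contributes [~~ t.2], in total [t.2]. *)
Lemma koszul_exchange_flip f i al x t be : uniq (al ++ x :: t :: be) -> flip t \in al ++ be ->
  x.1 != t.1 -> odd_idx (letter f x) -> odd_idx (letter (upd f t.1 i) t) ->
  koszul (oddf (upd f t.1 i) (al ++ x :: t :: be)) =
  t.2 (+) koszul (oddf f (sub t None (Some x) (al ++ t :: be))).
Proof.
move=> uw fw xt ox ot.
have ot' : odd_idx (letter (upd f t.1 i) (flip t)) by rewrite letter_flip odd_dual.
have xnt : x != t by apply: neq_labels.
have xnf : x != flip t by apply: neq_labels.
have uw' : uniq (al ++ t :: be).
  by apply: subseq_uniq uw; rewrite cat_subseq // subseq_cons.
have [xal xbe] : x \notin al /\ x \notin be.
  move: uw; rewrite (perm_uniq (permEl (perm_catCA al [:: x] (t :: be)))) /=.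
  by rewrite mem_cat inE !negb_or => /andP[/and3P[-> _ ->]].
have no v : x \notin v -> x \notin oddf f v by apply: contra; rewrite mem_filter => /andP[].
have nt v (s : tok) : s.1 = t.1 -> t.1 \notin labels v -> s \notin oddf f v.
  by move=> st nv; apply: contra nv; rewrite mem_filter -st => /andP[_ sv]; apply: map_f.
case: (split_flip uw' fw) => -[s1 [s2 [E [n1 n2 n3]]]]; rewrite E {uw uw' fw} in xal xbe *.
  move: xal; rewrite mem_cat inE !negb_or => /and3P[xs1 _ xs2].
  rewrite -!catA !cat_cons !(sub_cat, sub_t, sub_f) !sub_id // /oseq ?cat0s !cat_cons ?cat0s.
  rewrite !(oddf_cat, oddf_cons) ot ot' letter_upd // ox !oddf_upd //.
  rewrite koszul_exchange ?no ?nt // 1?eq_sym // -cat_cons catA koszul_flip_adj ?labels_oddf //.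
    by rewrite addNb negbK -catA.
  by rewrite /labels map_cat mem_cat negb_or /= inE negb_or eq_sym xt -!/(labels _) !labels_oddf.
move: xbe; rewrite mem_cat inE !negb_or => /and3P[xs1 _ xs2].
rewrite !(sub_cat, sub_t, sub_f) !sub_id // /oseq ?cat0s !cat_cons ?cat0s.
rewrite !(oddf_cat, oddf_cons) ot ot' letter_upd // ox !oddf_upd //.
rewrite -cat_cons koszul_exchange ?inE ?negb_or ?xnt ?flip_neq ?no ?nt // koszul_flip_adj ?labels_oddf //.
  by rewrite addNb negbK.
by rewrite /labels map_cat mem_cat negb_or /= inE negb_or eq_sym xt -!/(labels _) !labels_oddf.
Qed.

(** The letter at [t] dual to that of [x] brackets with it to the central [H], and [flip t] then
    carries the letter of [x]: the mark has jumped to the other end of the chord. The Casimir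
    coefficient and the Koszul sign leave a sign that depends only on which of Q- and Q+ moves. *)
Lemma term_H f j al x t be (i := if t.2 then dual j else j) (fi := upd f t.1 i) :
  uniq (al ++ x :: t :: be) -> flip t \in al ++ be ->
  x.1 != t.1 -> f x.1 = iM -> j = dual (letter f x) ->
  (cas_coef i)%:~R * ((-1) ^+ koszul (oddf fi (al ++ x :: t :: be)) * (wprod fi al * H * wprod fi be)) =
  (-1) ^+ (~~ x.2) * (H * term f (sub t None (Some x) (al ++ t :: be))).
Proof.
move=> uw fw xt fx jE.
have ltx : letter f x = if x.2 then iP else iM by rewrite /letter fx.
have ox : odd_idx (letter f x) by rewrite ltx; case: (x.2).
have ltt : letter fi t = j by apply: letter_of_flag.
have ltf : letter fi (flip t) = letter f x by rewrite letter_flip ltt jE dualK.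
have ot : odd_idx (letter fi t) by rewrite ltt jE odd_dual.
rewrite H_term koszul_exchange_flip // cas_coef_sign -?ltt // signz ltt jE ltx.
set S := koszul (oddf f _).
have -> : wprod fi al * H * wprod fi be = H * wprod f (sub t None (Some x) (al ++ t :: be)).
  have uw' : uniq (al ++ t :: be).
    by apply: subseq_uniq uw; rewrite cat_subseq // subseq_cons.
  case: (split_flip uw' fw) => -[s1 [s2 [E [n1 n2 n3]]]]; rewrite E {uw uw' fw S}.
    rewrite -!catA !cat_cons !(sub_cat, sub_t, sub_f) !sub_id // /oseq ?cat0s !cat_cons ?cat0s.
    rewrite !(wprod_cat, wprod_cons) ltf /fi !wprod_upd //.
    have C : GRing.comm H (wprod f s1 * (e (letter f x) * wprod f s2)).
      by apply: commrM; [exact: commH_pr rel _ _|apply: commrM; [exact: commH rel _|exact: commH_pr rel _ _]].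
    by rewrite -C !mulrA.
  rewrite !(sub_cat, sub_t, sub_f) !sub_id // /oseq ?cat0s !cat_cons ?cat0s.
  by rewrite !(wprod_cat, wprod_cons) ltf /fi !wprod_upd // -(commH_pr rel) !mulrA.
rewrite !mulrA; congr (_ * _ * _).
by case: (t.2); case: (x.2); case: S; rewrite /= ?expr0 ?expr1 ?mulr1 ?mul1r ?mulrNN ?mulr1.
Qed.

(** Only two of the four letters at [t] have a nonzero bracket with the odd letter at [x]: [G],
    which leaves that letter at [t], and the opposite odd generator, which leaves it at [flip t].
    Each produces a central [H]. *)
Lemma term_past_odd f x t al be : 
  uniq (al ++ x :: t :: be) -> flip t \in al ++ be -> x.1 != t.1 -> f x.1 = iM ->
  \sum_(i < 4) (cas_coef i)%:~R *
     (term (upd f t.1 i) (al ++ x :: t :: be) - term (upd f t.1 i) (al ++ t :: x :: be)) =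
  (-1) ^+ (~~ x.2) * (H * (term f (sub t None (Some x) (al ++ t :: be)) -
                           term f (sub t (Some x) None (al ++ t :: be)))).
Proof.
move=> uw fw xt fx; rewrite (sum_letter t.2) sum4.
have xnt : x != t by apply: neq_labels.
have uw' : uniq (al ++ t :: be).
  by apply: subseq_uniq uw; rewrite cat_subseq // subseq_cons.
rewrite !termB // !letter_of_flag // !(letter_upd _ _ xt).
have ltx : letter f x = if x.2 then iP else iM by rewrite /letter fx.
have TG := @term_G f (if t.2 then dual iG else iG) al x t be uw' fw xt (letter_of_flag _ _ erefl).
have TH := @term_H f (dual (letter f x)) al x t be uw fw xt fx erefl.
have [[P0 P1 P2 P3] [[M0 M1 M2 M3] _]] := scomE rel.
rewrite (cas_coef_even t.2 (j := iG)) // mul1r [in RHS]mulrBr [in RHS]mulrBr -TG -TH ltx {TG TH}.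
case: (x.2); rewrite /= ?(P0, P1, P2, P3, M0, M1, M2, M3).
  rewrite !(mulr0, mul0r, addr0, add0r) expr0 !mul1r addrC; congr (_ + _).
  by rewrite mulrN mulNr mulrN.
rewrite !(mulr0, mul0r, addr0, add0r) expr1 !mulN1r opprK addrC; congr (_ + _).
Qed.

Lemma term_swap_marks f a al be : f a = iM -> a \notin labels al -> a \notin labels be ->
  term f (al ++ (a, false) :: (a, true) :: be) - term f (al ++ (a, true) :: (a, false) :: be) =
  H * term f (al ++ be).
Proof.
move=> fa na nb; rewrite termB; last by rewrite xpair_eqE andbF.
rewrite H_term !(oddf_cat, oddf_cons) /letter /= fa /= koszul_pair_adj ?labels_oddf //.
congr (_ * _); have [_ [[_ _ -> _] _]] := scomE rel.
by rewrite wprod_cat -(commH_pr rel) mulrA.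
Qed.

(** The odd part of the tensor has coefficient 1 in the order Q-, Q+, and the coefficient -1 of the
    other order is the Koszul sign of the exchange. A chord with fixed odd letters may therefore be
    renamed [a] with letter [iM], its coefficient being absorbed. *)
Lemma term_relabel f f' a b t (j := if b then iP else iM) (fi := upd f t.1 (if t.2 then dual j else j)) w :
  uniq w -> t \in w -> flip t \in w -> f' a = iM -> t.1 != a -> a \notin labels w ->
  (forall n, n != a -> f' n = f n) ->
  (cas_coef (if t.2 then dual j else j))%:~R * term fi w =
  term f' (sub t (Some (a, b)) (Some (a, ~~ b)) w).
Proof.
move=> uw tw fw fa ta aw ff'.
have oj : odd_idx j by rewrite /j; case: (b).
have ltt : letter fi t = j by apply: letter_of_flag.
have ot : odd_idx (letter fi t) by rewrite ltt.
have ltf : letter fi (flip t) = dual j by rewrite letter_flip ltt.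
have otf : odd_idx (letter fi (flip t)) by rewrite ltf odd_dual.
have la : letter f' (a, b) = j by rewrite /letter /= fa /j; case: (b).
have la' : letter f' (a, ~~ b) = dual j by rewrite /letter /= fa /j; case: (b).
have oa : odd_idx (letter f' (a, b)) by rewrite la.
have oa' : odd_idx (letter f' (a, ~~ b)) by rewrite la' odd_dual.
have F v : t.1 \notin labels v -> a \notin labels v -> oddf fi v = oddf f' v /\ wprod fi v = wprod f' v.
  move=> tv av; rewrite /fi oddf_upd // wprod_upd //.
  have E x : x \in v -> letter f x = letter f' x.
    by move=> xv; rewrite /letter ff' // (notin_label av).
  by split; [apply: eq_in_filter => x /E ->|rewrite /wprod !big_seq; apply: eq_bigr => x /E ->].
have B : j == iP = b by rewrite /j; case: (b).
have {tw}[al [be wE]] : exists al be, w = al ++ t :: be by case/splitPr: tw => al be; exists al, be.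
rewrite cas_coef_sign // B signz /term mulrA.
rewrite wE in uw fw aw *.
have fw' : flip t \in al ++ be by move: fw; rewrite !mem_cat inE flip_neq.
case: (split_flip uw fw') => -[s1 [s2 [E [n1 n2 n3]]]]; rewrite E in aw *.
  rewrite -catA cat_cons !(sub_cat, sub_t, sub_f) !sub_id // /oseq ?cat0s !cat_cons ?cat0s.
  move: aw; rewrite !(notin_labels_cat, notin_labels_cons).
  move=> /andP[/andP[a1 /andP[_ a2]] /andP[_ a3]].
  have [F1 G1] := F _ n1 a1; have [F2 G2] := F _ n2 a2; have [F3 G3] := F _ n3 a3.
  rewrite !(wprod_cat, wprod_cons) ltt ltf la la' G1 G2 G3; congr (_ * _).
  rewrite !(oddf_cat, oddf_cons) ot otf oa oa' F1 F2 F3.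
  have -> : koszul (oddf f' s1 ++ flip t :: oddf f' s2 ++ t :: oddf f' be) =
      ~~ t.2 (+) odd (size (oddf f' s2)) (+) koszul (oddf f' s1 ++ oddf f' s2 ++ oddf f' be).
    by rewrite -{2}(flipK t) koszul_flip_pair ?labels_oddf.
  have -> : koszul (oddf f' s1 ++ (a, ~~ b) :: oddf f' s2 ++ (a, b) :: oddf f' be) =
      ~~ b (+) odd (size (oddf f' s2)) (+) koszul (oddf f' s1 ++ oddf f' s2 ++ oddf f' be).
    by rewrite -{2}(negbK b) koszul_pair ?labels_oddf.
  by case: (t.2); case: (b); case: (odd _); case: (koszul _); rewrite /= ?expr0 ?expr1 ?mulr1 ?mul1r ?mulrNN ?mulr1.
rewrite !(sub_cat, sub_t, sub_f) !sub_id // /oseq ?cat0s !cat_cons ?cat0s.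
move: aw; rewrite !(notin_labels_cat, notin_labels_cons).
move=> /andP[a1 /and3P[_ a2 /andP[_ a3]]].
have [F1 G1] := F _ n1 a1; have [F2 G2] := F _ n2 a2; have [F3 G3] := F _ n3 a3.
rewrite !(wprod_cat, wprod_cons) ltt ltf la la' G1 G2 G3; congr (_ * _).
rewrite !(oddf_cat, oddf_cons) ot otf oa oa' F1 F2 F3.
have -> : koszul (oddf f' al ++ t :: oddf f' s1 ++ flip t :: oddf f' s2) =
    t.2 (+) odd (size (oddf f' s1)) (+) koszul (oddf f' al ++ oddf f' s1 ++ oddf f' s2).
  by rewrite koszul_flip_pair ?labels_oddf.
rewrite koszul_pair ?labels_oddf //.
by case: (t.2); case: (b); case: (odd _); case: (koszul _); rewrite /= ?expr0 ?expr1 ?mulr1 ?mul1r ?mulrNN ?mulr1.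
Qed.

(** Since [G,Q+] = Q+ and [G,Q-] = -Q-, the bracket keeps the odd part of the chord of [t] and
    changes the sign of one of its two summands; the symmetric tensor becomes the antisymmetric
    one. *)
Lemma term_past_G f a t al be (f' := upd f a iM) :
  uniq (al ++ t :: be) -> flip t \in al ++ be -> f a = iG ->
  a \notin labels (al ++ t :: be) ->
  \sum_(i < 4) (cas_coef i)%:~R *
     (term (upd f t.1 i) (al ++ (a, false) :: t :: be) -
      term (upd f t.1 i) (al ++ t :: (a, false) :: be)) =
  term f' (sub t (Some (a, true)) (Some (a, false)) (al ++ t :: be)) -
  term f' (sub t (Some (a, false)) (Some (a, true)) (al ++ t :: be)).
Proof.
move=> uw fw fa aw; rewrite (sum_letter t.2) sum4.
have ta : t.1 != a.
  by apply: contraNneq aw => <-; rewrite /labels map_cat mem_cat inE eqxx orbT.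
have xt : (a, false).1 != t.1 by rewrite eq_sym.
have xnt : (a, false) != t by apply: neq_labels.
rewrite !termB // !letter_of_flag // !(letter_upd _ _ xt) /letter fa.
have tw : t \in al ++ t :: be by rewrite mem_cat inE eqxx orbT.
have fw' : flip t \in al ++ t :: be.
  by move: fw; rewrite !mem_cat inE => /orP[] ->; rewrite ?orbT.
have ff' n : n != a -> f' n = f n by move=> na; rewrite /f' updN.
have R b := @term_relabel f f' a b t _ uw tw fw' (updE _ _ _) ta aw ff'.
rewrite -(R true) -(R false) {R}.
have [_ [_ [-> -> -> ->]]] := scomE rel.
rewrite !(mulr0, mul0r, addr0, add0r).
have S i : oddf (upd f t.1 i) (al ++ (a, false) :: t :: be) = oddf (upd f t.1 i) (al ++ t :: be).
  by rewrite !(oddf_cat, oddf_cons) (letter_upd _ _ xt) /letter fa.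
rewrite !S mulrN mulNr !mulrN.
by congr (_ - _); rewrite /term wprod_cat wprod_cons letter_of_flag // !mulrA.
Qed.

Lemma casimirE : casimir e = \sum_(i < 4) (cas_coef i)%:~R * (e i * e (dual i)).
Proof.
apply: eq_bigr => i _; rewrite (bigD1 (dual i)) //= big1 ?addr0 // => j.
by case: (ord4P i) => ->; case: (ord4P j) => -> //= _; rewrite mul0r.
Qed.

Lemma casimir_comm i : GRing.comm (casimir e) (e i).
Proof.
case: rel => -[/eqP HG /eqP HP /eqP HM GP GM] [PM MP PP MM].
move: HG HP HM; rewrite !subr_eq0 => /eqP HG /eqP HP /eqP HM.
have P0 : Qp * Qp = 0 := half0 PP.
have M0 : Qm * Qm = 0 := half0 MM.
have cE : casimir e = H * G + G * H - Qp * Qm + Qm * Qp.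
  by rewrite casimirE sum4 /cas_coef /= !mul1r mulN1r.
have GPE : G * Qp = Qp * G + Qp by rewrite -[X in _ + X]GP addrCA subrr addr0.
have GME : G * Qm = Qm * G - Qm by rewrite -GM addrCA subrr addr0.
have PME : Qp * Qm = H - Qm * Qp by rewrite -PM addrK.
(* By [H,G] = 0 and [Q+,Q-] = H the Casimir element is [K + K - H], so it is enough that [K] is
   central. *)
pose K := H * G + Qm * Qp.
have {}cE : casimir e = K + K - H.
  by rewrite cE -HG PME opprB /K !addrA (addrAC _ (- H)) (addrAC (H * G) (Qm * Qp)).
apply/commr_sym; rewrite cE; apply: commrB; last exact/commr_sym/commH.
suff C : GRing.comm (e i) K by apply: commrD.
rewrite /GRing.comm /K.
case: (ord4P i) => -> /=.
- by rewrite mulrDr mulrDl !mulrA -(mulrA H G H) -HG HM -(mulrA Qm H) HP !mulrA.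
- by rewrite mulrDr mulrDl !mulrA -HG GME mulrBl -!mulrA GPE mulrDr addrK.
- rewrite mulrDr mulrDl !mulrA -HP PME mulrBl -!mulrA P0 !mulr0 addr0 subr0.
  by rewrite GPE mulrDr.
rewrite mulrDr mulrDl !mulrA M0 mul0r addr0 -HM -!mulrA PME mulrBr !mulrA M0 mul0r subr0.
by rewrite -(mulrA H G) GME mulrBr -HM subrK !mulrA.
Qed.

Lemma term_casimir f a al be : a \notin labels al -> a \notin labels be ->
  \sum_(i < 4) (cas_coef i)%:~R * term (upd f a i) (al ++ (a, false) :: (a, true) :: be) =
  casimir e * term f (al ++ be).
Proof.
move=> na nb; have C : GRing.comm (casimir e) (wprod f al).
  by apply: commr_prod => t _; apply: casimir_comm.
rewrite {2}/term mulrA (sign_comm _ (casimir e)) wprod_cat -mulrA mulrA.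
rewrite -(mulrA _ (casimir e)) (mulrA (casimir e)) C !mulrA casimirE.
rewrite mulr_sumr mulr_suml; apply: eq_bigr => i _.
rewrite /term wprod_cat !wprod_cons !wprod_upd // !(oddf_cat, oddf_cons) !oddf_upd //.
rewrite /letter /= updE odd_dual !mulrA.
have Z z : GRing.comm z ((cas_coef i)%:~R : A) by apply: commr_int.
rewrite (Z (_ * wprod f al)) !mulrA.
by case: (odd_idx i); rewrite ?koszul_pair_adj ?labels_oddf // .
Qed.

(** Supersymmetry of the Casimir tensor: exchanging the two ends of an odd chord changes both the
    coefficient and the Koszul sign. *)
Lemma term_flip f n c i al be ga :
  n \notin labels al -> n \notin labels be -> n \notin labels ga ->
  (cas_coef i)%:~R * term (upd f n i) (al ++ (n, c) :: be ++ (n, ~~ c) :: ga) =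
  (cas_coef (dual i))%:~R * term (upd f n (dual i)) (al ++ (n, ~~ c) :: be ++ (n, c) :: ga).
Proof.
move=> na nb ng; rewrite /term !(wprod_cat, wprod_cons) !wprod_upd //.
rewrite !(oddf_cat, oddf_cons) !oddf_upd //.
have E b j : letter (upd f n j) (n, b) = if b then dual j else j by rewrite /letter /= updE.
rewrite !E !mulrA.
have -> : (if ~~ c then dual (dual i) else dual i) = (if c then dual i else i).
  by case: c; rewrite ?dualK.
have -> : (if c then dual (dual i) else dual i) = (if ~~ c then dual i else i).
  by case: c; rewrite ?dualK.
have D : (if ~~ c then dual i else i) = dual (if c then dual i else i).
  by case: c; rewrite ?dualK.
rewrite D odd_dual; congr (_ * _ * _ * _ * _ * _).
set o := odd_idx _; have oE : o = odd_idx i by rewrite /o; case: c {E D o}; rewrite ?odd_dual.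
rewrite oE; case oi: (odd_idx i); last first.
  by have := cas_coef_even false (negbT oi); have := cas_coef_even true (negbT oi) => /= -> ->.
rewrite koszul_pair ?labels_oddf // -{3}(negbK c) koszul_pair ?labels_oddf //.
have := cas_coef_sign false oi; have := cas_coef_sign true oi => /= -> ->.
by rewrite !signz; case: (i == iP); case: c {E D o oE}; case: (odd _); case: (koszul _);
  rewrite /= ?expr0 ?expr1 ?mulr1 ?mul1r ?mulrNN ?mulr1.
Qed.
End Moves.

(** * Sums over the letters of the chords *)

Definition rml (n : nat) (L : seq nat) := [seq m <- L | m != n].
Definition rmt (n : nat) (w : seq tok) := [seq t <- w | t.1 != n].

Lemma mem_rml n L m : (m \in rml n L) = (m != n) && (m \in L).
Proof. by rewrite mem_filter. Qed.

Section ChordSums.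
Variables (A : algType CC) (H G Qp Qm : A).
Hypothesis rel : gl11_rel H G Qp Qm.

Local Notation e := (gen H G Qp Qm).
Local Notation term := (term H G Qp Qm).

(** The listed chords carry the Casimir tensor, all others keep the letter given by [f]; the list
    form lets a single chord be taken out of the sum. *)
Fixpoint sumL (L : seq nat) (F : (nat -> 'I_4) -> A) (f : nat -> 'I_4) : A :=
  if L is n :: L' then \sum_(i < 4) (cas_coef i)%:~R * sumL L' F (upd f n i) else F f.

Lemma sumL_ext L F F' f : (forall g, (forall n, n \notin L -> g n = f n) -> F g = F' g) ->
  sumL L F f = sumL L F' f.
Proof.
elim: L f => [|n L IH] f E /=; first exact: E.
apply: eq_bigr => i _; congr (_ * _); apply: IH => g Hg; apply: E => m.
by rewrite inE negb_or => /andP[mn mL]; rewrite Hg // updN.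
Qed.

Lemma sumLB L F F' f : sumL L (fun g => F g - F' g) f = sumL L F f - sumL L F' f.
Proof.
elim: L f => //= n L IH f; rewrite -sumrB; apply: eq_bigr => i _.
by rewrite IH mulrBr.
Qed.

Lemma sumL_mull L z F f : sumL L (fun g => z * F g) f = z * sumL L F f.
Proof.
elim: L f => //= n L IH f; rewrite mulr_sumr; apply: eq_bigr => i _.
have Z : GRing.comm z ((cas_coef i)%:~R : A) by apply: commr_int.
by rewrite IH !mulrA Z.
Qed.

Lemma sumL_sum L (F : 'I_4 -> (nat -> 'I_4) -> A) f :
  sumL L (fun g => \sum_(i < 4) F i g) f = \sum_(i < 4) sumL L (F i) f.
Proof.
elim: L f => //= n L IH f; under eq_bigr do rewrite IH mulr_sumr.
by rewrite exchange_big.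
Qed.

Lemma sumL_upd L F f a i : a \notin L ->
  sumL L F (upd f a i) = sumL L (fun g => F (upd g a i)) f.
Proof.
elim: L f => //= n L IH f; rewrite inE negb_or => /andP[an aL].
by apply: eq_bigr => j _; rewrite updC 1?eq_sym // IH.
Qed.

(** Making the sum over one chord innermost exposes the four terms to which an identity about that
    chord applies. *)
Lemma sumL_rml L n F f : uniq L -> n \in L ->
  sumL L F f = sumL (rml n L) (fun g => \sum_(i < 4) (cas_coef i)%:~R * F (upd g n i)) f.
Proof.
elim: L f => //= m L IH f /andP[mL uL]; rewrite inE eq_sym.
have [mn _|mn /= nL] := eqVneq m n; last first.
  by apply: eq_bigr => i _; rewrite IH.
rewrite -mn (_ : rml m L = L); last first.
  by apply/all_filterP/allP => x xL; apply: contraNneq mL => <-.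
rewrite sumL_sum; apply: eq_bigr => i _.
by rewrite sumL_mull sumL_upd.
Qed.

Lemma sumL_perm L L' F f : uniq L -> perm_eq L L' -> sumL L F f = sumL L' F f.
Proof.
elim: L L' F f => [|n L IH] L' F f; first by move=> _; rewrite perm_sym => /perm_nilP ->.
move=> uL pL; have uL' : uniq L' by rewrite -(perm_uniq pL).
have nL' : n \in L' by rewrite -(perm_mem pL) mem_head.
rewrite (sumL_rml _ _ uL (mem_head _ _)) (sumL_rml _ _ uL' nL').
have rE : rml n (n :: L) = L.
  by rewrite /rml /= eqxx; apply/all_filterP/allP => x xL; move: uL => /= /andP[nL _]; apply: contraNneq nL => <-.
rewrite rE; apply: IH; first by case/andP: uL.
by rewrite -{1}rE; apply: perm_filter.
Qed.

Variables (a : nat) (f0 : nat -> 'I_4).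

(* The chord [a] is not summed over in [EvI]: its letter is fixed to [i].  Thus
   [EvI iM] evaluates a word carrying Q- at [(a, false)] and Q+ at [(a, true)],
   with the Koszul sign that brings this pair in front. *)
Definition Ev L w := sumL L (fun g => term g w) f0.
Definition EvI i L w := sumL L (fun g => term (upd g a i) w) f0.

Local Notation a0 := (a, false).
Local Notation a1 := (a, true).
Local Notation V1 := (EvI iG).
Local Notation V3 := (EvI iM).

Lemma term_upd f n i w : n \notin labels w -> term (upd f n i) w = term f w.
Proof. by move=> nw; rewrite /term oddf_upd // wprod_upd. Qed.

Lemma EvI_odd_past L x t al be : x.1 = a -> uniq L -> t.1 \in L -> t.1 != a ->
  uniq (al ++ x :: t :: be) -> flip t \in al ++ be ->
  V3 L (al ++ x :: t :: be) - V3 L (al ++ t :: x :: be) =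
  (-1) ^+ (~~ x.2) * (H * (V3 (rml t.1 L) (sub t None (Some x) (al ++ t :: be)) -
                           V3 (rml t.1 L) (sub t (Some x) None (al ++ t :: be)))).
Proof.
move=> xa uL tL ta uw fw; rewrite /EvI -!sumLB -!sumL_mull (sumL_rml _ _ uL tL).
apply: sumL_ext => g _; rewrite -(term_past_odd rel) //; try by rewrite xa ?updE // eq_sym.
by apply: eq_bigr => i _; rewrite !(updC _ _ (n := a) (m := t.1)).
Qed.

Lemma EvI_G_past L t al be : uniq L -> t.1 \in L -> a \notin labels (al ++ t :: be) ->
  uniq (al ++ t :: be) -> flip t \in al ++ be ->
  V1 L (al ++ a0 :: t :: be) - V1 L (al ++ t :: a0 :: be) =
  V3 (rml t.1 L) (sub t (Some a1) (Some a0) (al ++ t :: be)) -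
  V3 (rml t.1 L) (sub t (Some a0) (Some a1) (al ++ t :: be)).
Proof.
move=> uL tL aw uw fw; rewrite /EvI -!sumLB (sumL_rml _ _ uL tL).
have ta : t.1 != a.
  by apply: contraNneq aw => <-; rewrite /labels map_cat mem_cat /= inE eqxx orbT.
apply: sumL_ext => g _; rewrite -(upd_upd g a iG iM) -(term_past_G rel) ?updE //.
by apply: eq_bigr => i _; rewrite !(updC _ _ (n := a) (m := t.1)).
Qed.

Lemma EvI_swap_marks L al be : a \notin labels al -> a \notin labels be ->
  V3 L (al ++ a0 :: a1 :: be) - V3 L (al ++ a1 :: a0 :: be) = H * Ev L (al ++ be).
Proof.
move=> na nb; rewrite /EvI /Ev -sumLB -sumL_mull; apply: sumL_ext => g _.
rewrite (term_swap_marks rel) ?updE // term_upd //.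
by rewrite notin_labels_cat na.
Qed.

(** With [G] at [a0], the mark [a1] carries the central letter [H], an even letter without influence
    on the sign. *)
Lemma EvI_H_out L al be : V1 L (al ++ a1 :: be) = H * V1 L (al ++ be).
Proof.
rewrite /EvI -sumL_mull; apply: sumL_ext => g _.
rewrite H_term /term !(oddf_cat, oddf_cons, wprod_cat, wprod_cons) /letter /= updE /=.
by congr (_ * _); rewrite !mulrA -(commH_pr rel).
Qed.

Definition Efull L w := \sum_(i < 4) (cas_coef i)%:~R * EvI i L w.

Lemma Efull_casimir L al be : a \notin labels al -> a \notin labels be ->
  Efull L (al ++ a0 :: a1 :: be) = casimir e * Ev L (al ++ be).
Proof.
move=> na nb; rewrite /Efull /Ev -sumL_mull; under eq_bigr do rewrite -sumL_mull.
rewrite -sumL_sum; apply: sumL_ext => g _.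
by rewrite (term_casimir rel).
Qed.

Lemma EvI_flip i c L al be ga :
  a \notin labels al -> a \notin labels be -> a \notin labels ga ->
  (cas_coef i)%:~R * EvI i L (al ++ (a, c) :: be ++ (a, ~~ c) :: ga) =
  (cas_coef (dual i))%:~R * EvI (dual i) L (al ++ (a, ~~ c) :: be ++ (a, c) :: ga).
Proof.
by move=> na nb ng; rewrite -!sumL_mull; apply: sumL_ext => g _; apply: term_flip.
Qed.

(** Supersymmetry replaces the letters [iH] and [iP] by [iG] and [iM] in the word with the marks
    exchanged. This splits the chord into its even part, the [V1] terms, and its odd part, the [V3]
    terms. *)
Lemma EfullE c L al be ga (w := al ++ (a, c) :: be ++ (a, ~~ c) :: ga)
    (w' := al ++ (a, ~~ c) :: be ++ (a, c) :: ga) :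
  a \notin labels al -> a \notin labels be -> a \notin labels ga ->
  Efull L w = V1 L w + V1 L w' + (V3 L w + V3 L w').
Proof.
move=> na nb ng; rewrite /Efull sum4 /w /w'.
have := EvI_flip iH c L na nb ng; have := EvI_flip iP c L na nb ng.
rewrite /= => -> ->; rewrite /cas_coef /= !mul1r (addrC (V1 L _)) -!addrA.
by congr (_ + (_ + _)); rewrite addrC.
Qed.

Lemma Efull_flip c L al be ga :
  a \notin labels al -> a \notin labels be -> a \notin labels ga ->
  Efull L (al ++ (a, c) :: be ++ (a, ~~ c) :: ga) =
  Efull L (al ++ (a, ~~ c) :: be ++ (a, c) :: ga).
Proof.
move=> na nb ng; have := @EfullE (~~ c) L al be ga na nb ng.
rewrite negbK EfullE // => ->.
by congr (_ + _); apply: addrC.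
Qed.

(** A telescoping sum over the ends passed. Meeting the partner mark is special: there [Q+,Q-] = H
    erases both marks, leaving an ordinary value [Ev]. *)
Lemma EvI_odd_move L x al de ze (w := al ++ de ++ ze) :
  x.1 = a -> uniq L -> uniq (x :: w) ->
  {in w, forall s, s.1 != a -> (s.1 \in L) && (flip s \in w)} ->
  V3 L (al ++ x :: de ++ ze) - V3 L (al ++ de ++ x :: ze) =
  (-1) ^+ (~~ x.2) * (H * (\sum_(s <- de | s.1 != a)
      (V3 (rml s.1 L) (sub s None (Some x) w) - V3 (rml s.1 L) (sub s (Some x) None w))))
  + (if flip x \in de then (-1) ^+ x.2 * (H * Ev L (rmt a w)) else 0).
Proof.
move=> xa uL; rewrite {}/w; elim: de al => [|s de IH] al uw Hw.
  by rewrite big_nil !mulr0 addr0 subrr.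
rewrite -[LHS](subrKA (V3 L (al ++ s :: x :: de ++ ze))).
have E := IH (rcons al s); rewrite !cat_rcons in E; rewrite {}E // {IH}.
move: uw; rewrite (perm_uniq (_ : perm_eq _ (al ++ x :: s :: de ++ ze))); last first.
  by rewrite perm_sym (permEl (perm_catCA al [:: x] _)).
move=> uw; rewrite big_cons.
(* An end labelled [a] can only be the partner of [x]; the rest of [de] then has no further mark. *)
have [sa|sa] := eqVneq s.1 a.
  have xs : s != x.
    apply: contraTneq uw => ->; rewrite (perm_uniq (permEl (perm_catCA al [:: x] _))) /=.
    by rewrite mem_cat inE eqxx orbT.
  have {xs}sE : s = flip x.
    by have [E|//] := @tok_label_eq x s (etrans sa (esym xa)); rewrite E eqxx in xs.
  have nota v : {subset v <= al ++ de ++ ze} -> a \notin labels v.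
    move=> sv; apply/labelsP => -[b /sv bv]; move: uw.
    rewrite (perm_uniq (permEl (perm_catCA al [:: x; s] _))) /= inE => /and3P[/norP[_ xv] sv' _].
    have [E|E] := @tok_label_eq x (a, b) (esym xa); move: bv; rewrite E; apply/negP => //.
    by rewrite -sE.
  have na : a \notin labels al by apply: nota => y; rewrite mem_cat => ->.
  have nb : a \notin labels (de ++ ze) by apply: nota => y yv; rewrite mem_cat yv orbT.
  have fde : flip x \in de = false.
    apply: contraNF nb => H'; rewrite /labels map_cat mem_cat -/(labels de).
    by apply/orP; left; rewrite -xa; apply: (map_f fst H').
  rewrite fde addr0 sE mem_head addrC; congr (_ + _).
  have -> : rmt a (al ++ flip x :: de ++ ze) = al ++ de ++ ze.
    rewrite /rmt filter_cat /= xa eqxx /=; congr (_ ++ _); apply/all_filterP/allP => y yv.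
      exact: notin_label na yv.
    exact: notin_label nb yv.
  case: x xa {uw sE Hw fde} => _ [] /= ->; rewrite /flip /=.
    by rewrite -EvI_swap_marks // expr1 mulN1r opprB.
  by rewrite EvI_swap_marks // mul1r.
have /andP[sL fs] : (s.1 \in L) && (flip s \in al ++ s :: de ++ ze).
  by apply: Hw => //; rewrite mem_cat inE eqxx orbT.
rewrite EvI_odd_past //; last first.
  by move: fs; rewrite !mem_cat inE flip_neq mem_cat.
rewrite in_cons (_ : (flip x == s) = false); last first.
  by apply: contraNF sa => /eqP <-; rewrite -xa.
by rewrite addrA -!mulrDr.
Qed.

End ChordSums.

(** * Moving one end of a chord towards the other *)

(** Two uses of [put], with the marks [(a, false)] and [(a, true)], turn two chords into one joining
    a chosen end of each. *)
Definition put (t c : tok) : seq tok -> seq tok := sub t (Some c) None.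
Arguments put : simpl never.

Lemma put_absent t c w : t \notin w -> put t c w = rmt t.1 w.
Proof.
elim: w => // x w IH; rewrite inE negb_or eq_sym => /andP[xt tw].
rewrite /put /= (negPf xt) /= -/(put t c w) IH //.
have [->|xf] := eqVneq x (flip t); first by rewrite eqxx.
rewrite ifT //; apply: contraNneq xf => xE.
by have [E|->] := tok_label_eq xE; first by rewrite E eqxx in xt.
Qed.

Lemma sub_absent t o o' o2 w : t \notin w -> sub t o o' w = sub t o2 o' w.
Proof.
elim: w => // x w IH; rewrite inE negb_or eq_sym => /andP[xt tw].
by rewrite /sub /= (negPf xt) -!/(sub _ _ _ _) (IH tw).
Qed.

Lemma sub_put t c w : sub t None (Some c) w = put (flip t) c w.
Proof. by rewrite /put sub_flip. Qed.

Lemma rmt_cat n v w : rmt n (v ++ w) = rmt n v ++ rmt n w.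
Proof. exact: filter_cat. Qed.

Lemma mem_put t c w y :
  (y \in put t c w) = ((t \in w) && (y == c)) || ((y \in w) && (y.1 != t.1)).
Proof.
elim: w => //= x w IH; rewrite /put /= -/(put t c w) !inE (eq_sym t).
have [->|xt] := eqVneq x t; rewrite /= ?inE ?IH.
  have [->|_] := eqVneq y t; first by rewrite ?eqxx ?andbF ?orbF; case: (t == c); case: (t \in w).
  by case: (y == c); case: (t \in w).
have [->|xf] := eqVneq x (flip t); rewrite /= ?IH.
  by have [->|//] := eqVneq y (flip t); rewrite /= eqxx !andbF.
rewrite inE IH; have [->|yx] := eqVneq y x => //=.
have -> : x.1 != t.1.
  by apply: contraNneq xf => xE; have [E|->] := tok_label_eq xE; first by rewrite E eqxx in xt.
by rewrite orbT.
Qed.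

Lemma put_uniq t c w : uniq w -> c \notin w -> uniq (put t c w).
Proof.
elim: w => //= x w IH /andP[xw uw]; rewrite inE negb_or => /andP[cx nc].
rewrite /put /= -/(put t c w).
have [xt|xt] := eqVneq x t; rewrite /= ?IH // ?andbT.
  by rewrite mem_put -xt (negPf xw) (negPf nc).
case: ifP => _ /=; rewrite ?IH // andbT mem_put (negPf xw) orbF.
by apply: contraNN cx => /andP[_ /eqP ->].
Qed.

Lemma rmt_put n t c w : c.1 = n -> n \notin labels w -> rmt n (put t c w) = rmt t.1 w.
Proof.
move=> cn; elim: w => //= x w IH; rewrite inE negb_or => /andP[nx nw].
rewrite /put /= -/(put t c w).
have [->|xt] := eqVneq x t; first by rewrite /= cn !eqxx /= IH.
have [->|xf] := eqVneq x (flip t); first by rewrite /= eqxx /= IH.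
rewrite /= eq_sym nx IH // ifT //.
by apply: contraNneq xf => xE; have [E|->] := tok_label_eq xE; first by rewrite E eqxx in xt.
Qed.

Lemma valid_flip w x : valid w -> x \in w -> flip x \in w.
Proof. by case/andP=> _ /allP; apply. Qed.

Lemma sub_cross (V : zmodType) (p q r s q' r' s' : V) :
  (p + q + (r + s)) - (p + q' + (r' + s')) = (q - q') - (r' - r) - (s' - s).
Proof.
by rewrite !opprD !opprK !addrA [LHS](ACl ((1*5)*(2*6*7*3*8*4))) /= subrr add0r.
Qed.

(** Here [x] and [y] are the two halves of Omega(t,t'), which cancel; [f1] and [f2] are the two
    orders of adjacent marks at t, [r] is the meeting of the marks at t', and [sa] to [sd] collect
    the other ends passed. *)
Lemma regroup (V : zmodType) (x y f1 f2 sa sb sc sd r : V) :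
  x - y + (f1 - sa - (f2 + sb) - (x + (- sc + r)) + (y + (sd - r))) =
  f1 - f2 - r - r + (sc + sd - sa - sb).
Proof.
by rewrite !opprD !opprK !addrA [LHS](ACl ((1*7)*(2*10)*(3*5*9*12*8*11*4*6))) /= subrr addNr !add0r.
Qed.

Section Step.
Variables (A : algType CC) (H G Qp Qm : A).
Hypothesis rel : gl11_rel H G Qp Qm.
Variables (a : nat) (f0 : nat -> 'I_4).

Local Notation e := (gen H G Qp Qm).
Local Notation term := (term H G Qp Qm).
Local Notation Ev := (Ev H G Qp Qm f0).
Local Notation V1 := (EvI H G Qp Qm a f0 iG).
Local Notation V3 := (EvI H G Qp Qm a f0 iM).
Local Notation Efull := (Efull H G Qp Qm a f0).
Local Notation a0 := (a, false).
Local Notation a1 := (a, true).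

(** One mark stays at [u] while the other is carried across [b1]; they meet exactly when [u] lies in
    [b1]. *)
Lemma EvI_put_move L c u al b1 ze (B := al ++ b1 ++ ze) :
  c.1 = a -> a \notin labels B -> uniq L -> {in B, forall s, s.1 \in L} -> valid B -> u \in B ->
  V3 (rml u.1 L) (put u (flip c) (al ++ c :: b1 ++ ze)) =
  V3 (rml u.1 L) (put u (flip c) (al ++ b1) ++ c :: put u (flip c) ze) +
  ((-1) ^+ (~~ c.2) * (H * (\sum_(s <- b1 | s.1 != u.1)
      (V3 (rml s.1 (rml u.1 L)) (put (flip s) c (put u (flip c) B)) -
       V3 (rml s.1 (rml u.1 L)) (put s c (put u (flip c) B)))))
  + (if u \in b1 then (-1) ^+ c.2 * (H * Ev (rml u.1 L) (rmt u.1 B)) else 0)).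
Proof.
move=> ca aB uL BL vB uB; set P := put u (flip c).
have fa : (flip c).1 = a by [].
have nc (v : seq tok) : {subset v <= B} -> c \notin v.
  by move=> sv; apply: contra aB => /sv cB; rewrite -ca; apply: (map_f fst).
have nfc (v : seq tok) : {subset v <= B} -> flip c \notin v.
  by move=> sv; apply: contra aB => /sv cB; rewrite -ca; apply: (map_f fst cB).
have cu : c.1 != u.1 by rewrite ca; apply: contraNneq aB => ->; apply: (map_f fst).
have uB' : uniq B by case/andP: vB.
have -> : P (al ++ c :: b1 ++ ze) = P al ++ c :: P b1 ++ P ze.
  by rewrite /P /put sub_cat sub_n // sub_cat.
have -> : P (al ++ b1) ++ c :: P ze = P al ++ P b1 ++ c :: P ze.
  by rewrite /P /put sub_cat catA.
have PB : P B = P al ++ P b1 ++ P ze by rewrite /P /put !sub_cat.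
have mP x : x \in P B -> x.1 != a -> x \in B /\ x.1 != u.1.
  rewrite mem_put => /orP[/andP[_ /eqP ->]|/andP[] //].
  by rewrite /= ca eqxx.
have E := @EvI_odd_move _ H G Qp Qm rel a f0 (rml u.1 L) c (P al) (P b1) (P ze) ca.
rewrite -PB in E; rewrite [RHS]addrC; apply/eqP; rewrite -subr_eq; apply/eqP.
rewrite {}E.
- congr (_ * (_ * _) + _).
    rewrite -big_filter -[in RHS]big_filter.
    have -> : [seq i <- P b1 | i.1 != a] = [seq i <- b1 | i.1 != u.1].
      by apply: rmt_put => //; move: aB; rewrite !notin_labels_cat => /and3P[].
    by apply: eq_bigr => s _; rewrite sub_put.
  rewrite mem_put (negPf (nfc _ _)) /= ?andbF ?orbF ?eqxx ?andbT; last first.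
    by move=> s sb; rewrite !mem_cat sb orbT.
  by rewrite rmt_put.
- by apply/filter_uniq.
- rewrite /= put_uniq ?nfc // andbT mem_put (negPf (nc _ _)) // orbF negb_and.
  by rewrite eq_sym flip_neq orbT.
move=> s sP sa; have [sB su] := mP _ sP sa.
rewrite mem_rml su BL //= mem_put /= su andbT.
by rewrite valid_flip ?orbT.
Qed.

Definition K L B s t :=
  V3 (rml s.1 (rml t.1 L)) (put s a0 (put t a1 B)) +
  V3 (rml s.1 (rml t.1 L)) (put s a1 (put t a0 B)).

Definition kappa L B s t := K L B s t - K L B (flip s) t - K L B s (flip t) + K L B (flip s) (flip t).

Lemma Efull_step1 L al b1 t ga (B := al ++ b1 ++ t :: ga) (L' := rml t.1 L) (t' := flip t) :
  a \notin labels B -> uniq L -> {in B, forall s, s.1 \in L} -> valid B ->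
  Efull L (al ++ a0 :: (b1 ++ [:: t]) ++ a1 :: ga) - Efull L (al ++ a0 :: b1 ++ a1 :: t :: ga) =
  H * (V3 L' (sub t (Some a0) (Some a1) B) - V3 L' (sub t (Some a1) (Some a0) B) +
       (V3 L' (put t a1 (al ++ a0 :: b1 ++ t :: ga)) - V3 L' (put t a0 (al ++ a1 :: b1 ++ t :: ga))
        - V3 L' (put t' a1 (al ++ a0 :: b1 ++ t :: ga)) + V3 L' (put t' a0 (al ++ a1 :: b1 ++ t :: ga)))).
Proof.
move=> aB uL BL vB.
have [aal [ab [at_ aga]]] : a \notin labels al /\ a \notin labels b1 /\ (a != t.1) /\ a \notin labels ga.
  by move: aB; rewrite !notin_labels_cat notin_labels_cons => /and4P[].
have tB : t \in B by rewrite !mem_cat mem_head !orbT.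
have tL := BL _ tB.
have uB : uniq B by case/andP: vB.
have fB := valid_flip vB tB.
have F : flip t \in al ++ b1 ++ ga by move: fB; rewrite !mem_cat inE flip_neq.
have U c : c.1 = a -> c \notin B.
  by move=> ca; apply: contra aB => cB; rewrite -ca; apply: (map_f fst cB).
have U2 c d : c.1 = a -> d.1 = a -> c != d -> uniq ((al ++ c :: b1) ++ d :: t :: ga).
  move=> ca da cd.
  rewrite (perm_uniq (_ : perm_eq _ ([:: c; d] ++ B))); last first.
    apply/permP => p; rewrite /B !count_cat /= -!addnA.
    by rewrite (addnCA (count p al) (p c)) (addnCA (count p b1) (p d)) (addnCA (count p al) (p d)).
  by rewrite /= inE negb_or cd !U.
have F2 c : flip t \in (al ++ c :: b1) ++ ga.
  move: F; rewrite !mem_cat inE => /or3P[] ->; rewrite ?orbT //.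
have abt : a \notin labels (b1 ++ [:: t]) by rewrite notin_labels_cat ab notin_labels_cons at_.
have agt : a \notin labels (t :: ga) by rewrite notin_labels_cons at_.
have -> := @EfullE _ H G Qp Qm a f0 false L al _ ga aal abt aga.
have -> := @EfullE _ H G Qp Qm a f0 false L al _ (t :: ga) aal ab agt.
rewrite /= -!catA !cat1s.
have ta : t.1 != a by rewrite eq_sym.
(* The moving end carries the central [H] here, so nothing changes. *)
have X1 : V1 L (al ++ a0 :: b1 ++ t :: a1 :: ga) = V1 L (al ++ a0 :: b1 ++ a1 :: t :: ga).
  have := EvI_H_out rel a f0 L (al ++ a0 :: b1) (t :: ga).
  have := EvI_H_out rel a f0 L (al ++ a0 :: b1 ++ [:: t]) ga.
  by rewrite /= -!catA /= -!catA /= => -> ->.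
(* The moving end carries [G], and passing [t] leaves Omega on the chord of [t]; the [H] at the left
   end gives the factor. *)
have X2 : V1 L (al ++ a1 :: b1 ++ t :: a0 :: ga) - V1 L (al ++ a1 :: b1 ++ a0 :: t :: ga) =
    H * (V3 L' (sub t (Some a0) (Some a1) B) - V3 L' (sub t (Some a1) (Some a0) B)).
  rewrite !(EvI_H_out rel) -mulrBr; congr (_ * _).
  have := EvI_G_past rel f0 uL tL (al := al ++ b1) (be := ga) (a := a).
  rewrite -!catA => E; rewrite -opprB E // opprB //.
have n01 : a0 != a1 by rewrite xpair_eqE andbF.
have n10 : a1 != a0 by rewrite eq_sym.
(* [X3] moves Q+ and [X4] moves Q-; together they supply the tensors between the left end of [a] and
   the two ends of the chord of [t]. *)
have X3 := @EvI_odd_past _ H G Qp Qm rel a f0 L a1 t _ _ erefl uL tL ta (U2 a0 a1 erefl erefl n01) (F2 a0).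
have X4 := @EvI_odd_past _ H G Qp Qm rel a f0 L a0 t _ _ erefl uL tL ta (U2 a1 a0 erefl erefl n10) (F2 a1).
move: X3 X4; rewrite /= !mul1r !mulN1r -!catA !cat_cons !sub_put -!/(put _ _ _) -/L' => X3 X4.
rewrite X1 sub_cross X2 X3 X4 opprK -mulrBr -mulrDr; congr (_ * _).
by rewrite opprB -addrA; congr (_ + _); rewrite !addrA [LHS](ACl (1*4*2*3)) /=.
Qed.


(** The two orders of the marks at [t] differ by [H * V]. If the other end of the chord lies in
    [b1], the mark also meets its partner there, once for each assignment of Q- and Q+, which
    subtracts [H * V] twice and reverses the sign. *)
Lemma Efull_step L al b1 t ga (B := al ++ b1 ++ t :: ga) (V := Ev (rml t.1 L) (rmt t.1 B)) :
  a \notin labels B -> uniq L -> {in B, forall s, s.1 \in L} -> valid B ->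
  Efull L (al ++ a0 :: (b1 ++ [:: t]) ++ a1 :: ga) - Efull L (al ++ a0 :: b1 ++ a1 :: t :: ga) =
  H * (H * ((if flip t \in b1 then - V else V) + \sum_(s <- b1 | s.1 != t.1) kappa L B s t)).
Proof.
move=> aB uL BL vB; rewrite Efull_step1 // -/B.
have [aal [ab [at_ aga]]] : a \notin labels al /\ a \notin labels b1 /\ (a != t.1) /\ a \notin labels ga.
  by move: aB; rewrite !notin_labels_cat notin_labels_cons => /and4P[].
have tB : t \in B by rewrite !mem_cat mem_head !orbT.
have fB := valid_flip vB tB.
have uB : uniq B by case/andP: vB.
have [tal tb1 tga] : [/\ t \notin al, t \notin b1 & t \notin ga].
  move: uB; rewrite /B catA (perm_uniq (permEl (perm_catCA (al ++ b1) [:: t] ga))) /=.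
  by rewrite !mem_cat !negb_or => /andP[/andP[/andP[-> ->] ->]].
have M c u := @EvI_put_move L c u al b1 (t :: ga).
have E0 := M a0 t erefl aB uL BL vB tB.
have E1 := M a1 t erefl aB uL BL vB tB.
have E2 := M a0 (flip t) erefl aB uL BL vB fB.
have E3 := M a1 (flip t) erefl aB uL BL vB fB.
rewrite -/B /= in E0 E1 E2 E3; rewrite {}E0 {}E1 {}E2 {}E3 (negPf tb1) -/V.
have Pt c : put t c (t :: ga) = c :: rmt t.1 ga.
  by rewrite /put sub_t /= -/(put t c ga) put_absent.
have Pf c d : put (flip t) c (al ++ b1) ++ d :: put (flip t) c (t :: ga) = sub t (Some d) (Some c) B.
  rewrite -!sub_put /B [in RHS]catA (sub_cat _ _ _ (al ++ b1)) sub_t [in RHS]sub_t.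
  by rewrite (sub_absent None (Some c) (Some d) (w := al ++ b1)) ?mem_cat ?negb_or ?tal // (sub_absent None (Some c) (Some d) (w := ga)).
have PA c : put t c (al ++ b1) = rmt t.1 (al ++ b1) by rewrite put_absent // mem_cat negb_or tal.
rewrite !Pt !Pf !PA.
have FV : V3 (rml t.1 L) (rmt t.1 (al ++ b1) ++ a0 :: a1 :: rmt t.1 ga) -
    V3 (rml t.1 L) (rmt t.1 (al ++ b1) ++ a1 :: a0 :: rmt t.1 ga) = H * V.
  rewrite (EvI_swap_marks rel).
  - by congr (_ * Ev _ _); rewrite /B catA !rmt_cat /= eqxx.
  - by apply: contra aB => /labelsP[b]; rewrite mem_filter mem_cat => /andP[_ H'];
      apply/labelsP; exists b; rewrite /B catA mem_cat mem_cat H'.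
  by apply: contra aB => /labelsP[b]; rewrite mem_filter => /andP[_ H'];
    apply/labelsP; exists b; rewrite /B catA mem_cat inE H' !orbT.
congr (_ * _).
set X := V3 _ (sub _ _ _ _); set Y := V3 _ (sub _ _ _ _).
rewrite !expr0 !expr1 !mul1r !mulN1r !addr0.
have -> : (if flip t \in b1 then - (H * V) else 0) = - (if flip t \in b1 then H * V else 0).
  by case: ifP; rewrite ?oppr0.
rewrite regroup FV [RHS]mulrDr; congr (_ + _).
  by case: ifP => _; rewrite ?mulrN ?subr0 // subrr add0r.
rewrite -mulrDr -!mulrBr; congr (_ * _); rewrite -!big_split -!sumrB /=; apply: eq_bigr => s _.
rewrite /kappa /K !addrA !opprB !opprD.
by rewrite !addrA [LHS](ACl (5*7*6*8*2*4*1*3)).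
Qed.
End Step.

(** * Cancellation of the chords that do not intersect the given one *)

(* For the word of an arc: its ends of the chords that leave the arc. *)
Definition unpaired (w : seq tok) := [seq t <- w | flip t \notin w].

Lemma put_cons u y z v : put u y (z :: v) =
  (if z == u then [:: y] else if z == flip u then [::] else [:: z]) ++ put u y v.
Proof. by rewrite /put /sub /=; case: ifP => // _; case: ifP. Qed.

Lemma put_comm s c t d w : s.1 != t.1 -> c.1 != t.1 -> d.1 != s.1 ->
  put s c (put t d w) = put t d (put s c w).
Proof.
move=> st ct ds; elim: w => // x w IH.
have neq (y u : tok) : y.1 != u.1 -> (y == u) = false /\ (y == flip u) = false.
  by move=> yu; split; apply: contraNF yu => /eqP ->.
have ts : t.1 != s.1 by rewrite eq_sym.
rewrite (put_cons t) (put_cons s).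
have [xt|xt] := eqVneq x t.
  have [E1 E2] := neq t s ts; have [E3 E4] := neq _ _ ds.
  by rewrite xt E1 E2 (put_cons s) E3 E4 (put_cons t) eqxx IH.
have [xf|xf] := eqVneq x (flip t).
  have [E1 E2] := neq (flip t) s ts.
  by rewrite xf E1 E2 /= (put_cons t) flip_neq eqxx IH.
rewrite (put_cons s).
case: ifP => _; first by have [E1 E2] := neq _ _ ct; rewrite (put_cons t) E1 E2 IH.
case: ifP => _; first by rewrite IH.
by rewrite (put_cons t) (negPf xt) (negPf xf) IH.
Qed.

Lemma rml_comm m n L : rml m (rml n L) = rml n (rml m L).
Proof. by rewrite /rml -!filter_predI; apply: eq_filter => x /=; rewrite andbC. Qed.

Lemma unpaired_rcons w t : uniq (rcons w t) ->
  unpaired (rcons w t) = if flip t \in w then [seq s <- unpaired w | s != flip t]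
                         else rcons (unpaired w) t.
Proof.
rewrite rcons_uniq => /andP[tw uw].
rewrite /unpaired filter_rcons mem_rcons inE flip_neq /=.
have -> : [seq s <- w | flip s \notin rcons w t] = [seq s <- [seq s <- w | flip s \notin w] | s != flip t].
  rewrite -filter_predI; apply: eq_filter => s /=.
  by rewrite mem_rcons inE negb_or (inv_eq flipK).
case: (boolP (flip t \in w)) => //= fw; congr rcons.
apply/all_filterP/allP => s; rewrite mem_filter => /andP[_ sw].
by apply: contraNneq fw => <-.
Qed.

Section Cancel.
Variables (A : algType CC).

Lemma double_inj (x y : A) : x + x = y + y -> x = y.
Proof. by move=> E; apply/eqP; rewrite -subr_eq0; apply/eqP/half0; rewrite addrACA E -opprD subrr. Qed.

(** Along the arc, the second end of a chord subtracts what its first end added. *)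
Lemma sum_unpaired_rcons w t (g : tok -> A) : uniq (rcons w t) -> g (flip t) = g t ->
  \sum_(s <- unpaired (rcons w t)) g s =
  \sum_(s <- unpaired w) g s + (if flip t \in w then - g t else g t).
Proof.
move=> u gt; rewrite unpaired_rcons //; case: ifP => fw; last by rewrite big_rcons.
have ut : t \notin w by move: u; rewrite rcons_uniq => /andP[].
have fu : flip t \in unpaired w by rewrite mem_filter flipK ut.
have uu : uniq (unpaired w) by apply: filter_uniq; move: u; rewrite rcons_uniq => /andP[].
by rewrite (bigD1_seq _ fu uu) /= gt big_filter [RHS]addrC addKr.
Qed.

(** On the chords with both ends in [w], [flip] permutes the summands and negates them, so their sum
    is its own negative. *)
Lemma sum_flip_odd w (P : pred tok) (F : tok -> A) : uniq w ->
  (forall t, P (flip t) = P t) -> (forall t, F (flip t) = - F t) ->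
  \sum_(t <- w | P t) F t = \sum_(t <- unpaired w | P t) F t.
Proof.
move=> uw Pf Ff; rewrite /unpaired big_filter_cond (bigID (fun t => flip t \in w)) /=.
rewrite [X in X + _](_ : _ = 0) ?add0r; first by apply: eq_bigl => t; rewrite andbC.
apply: half0; set S := \sum_(_ <- _ | _) _.
suff E : S = - S by rewrite {1}E addNr.
rewrite {1}/S -big_filter -(perm_big _ (_ : perm_eq (map flip [seq t <- w | P t && (flip t \in w)]) _)).
  by rewrite big_map big_filter /S -sumrN; apply: eq_bigr => t _; apply: Ff.
apply: uniq_perm; first by rewrite (map_inj_uniq (inv_inj flipK)) filter_uniq.
  exact: filter_uniq.
move=> t; rewrite -{1}(flipK t) (mem_map (inv_inj flipK)) !mem_filter Pf flipK.
by case: (P t) => //=; rewrite andbC.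
Qed.

Lemma double_sum_ltn (s : seq nat) (F : nat -> nat -> A) : uniq s ->
  {in s &, forall x y, F x y = F y x} ->
  \sum_(x <- s) \sum_(y <- s | y != x) F x y =
  (\sum_(i < size s) \sum_(j < size s | (i < j)%N) F (nth 0%N s i) (nth 0%N s j)) *+ 2.
Proof.
move=> us Fs; rewrite (big_nth 0%N) big_mkord.
have E (i : 'I_(size s)) : \sum_(y <- s | y != nth 0%N s i) F (nth 0%N s i) y =
    \sum_(j < size s | (i < j)%N) F (nth 0%N s i) (nth 0%N s j) +
    \sum_(j < size s | (j < i)%N) F (nth 0%N s i) (nth 0%N s j).
  rewrite (big_nth 0%N) big_mkord (bigID (fun j : 'I_(size s) => (i < j)%N)) /=.
  by congr (_ + _); apply: eq_bigl => j; rewrite nth_uniq // eq_sym; case: ltngtP.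
rewrite (eq_bigr _ (fun i _ => E i)) big_split /= mulr2n; congr (_ + _).
rewrite (exchange_big_dep xpredT) //=; apply: eq_bigr => i _; apply: eq_bigr => j _.
by rewrite Fs ?mem_nth.
Qed.

Variables (H G Qp Qm : A).
Hypothesis rel : gl11_rel H G Qp Qm.
Variables (a : nat) (f0 : nat -> 'I_4).

Local Notation e := (gen H G Qp Qm).
Local Notation Ev := (Ev H G Qp Qm f0).
Local Notation V1 := (EvI H G Qp Qm a f0 iG).
Local Notation V3 := (EvI H G Qp Qm a f0 iM).
Local Notation Efull := (Efull H G Qp Qm a f0).
Local Notation K := (K H G Qp Qm a f0).
Local Notation kappa := (kappa H G Qp Qm a f0).
Local Notation a0 := (a, false).
Local Notation a1 := (a, true).

Lemma kappa_flipl L B s t : kappa L B (flip s) t = - kappa L B s t.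
Proof. by rewrite /kappa /kappa flipK !opprD !opprK [LHS](ACl (2*1*4*3)) /=. Qed.

Lemma kappa_flipr L B s t : kappa L B s (flip t) = - kappa L B s t.
Proof. by rewrite /kappa /kappa flipK !opprD !opprK [LHS](ACl (3*4*1*2)) /=. Qed.

Lemma K_sym L B s t : s.1 != t.1 -> s.1 != a -> t.1 != a -> K L B s t = K L B t s.
Proof.
move=> st sa ta; rewrite /K addrC (rml_comm s.1).
by congr (_ + _); congr (EvI _ _ _ _ _ _ _ _ _); apply: put_comm => //=; rewrite eq_sym.
Qed.

Lemma kappa_sym L B s t : s.1 != t.1 -> s.1 != a -> t.1 != a -> kappa L B s t = kappa L B t s.
Proof.
move=> st sa ta; rewrite /kappa !(K_sym _ _ (s := s)) // !(K_sym _ _ (s := flip s)) //.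
by congr (_ + _); rewrite addrAC.
Qed.

(** [P] is the sum of kappa over pairs with s before t on the arc. Only its double is recorded,
    because that no longer depends on the order of the arc. *)
Lemma Efull_expand L al be ga (B := al ++ be ++ ga) :
  a \notin labels B -> uniq L -> {in B, forall s, s.1 \in L} -> valid B ->
  exists2 P, P + P = \sum_(s <- be) \sum_(t <- be | t.1 != s.1) kappa L B s t
    & Efull L (al ++ a0 :: be ++ a1 :: ga) = casimir e * Ev L B +
      H * (H * (\sum_(t <- unpaired be) Ev (rml t.1 L) (rmt t.1 B) + P)).
Proof.
move=> aB uL BL vB; have uB : uniq B by case/andP: vB.
rewrite /B; elim/last_ind: be ga @B aB BL vB uB => [|be t IH] ga B aB BL vB uB.
  exists 0; first by rewrite big_nil addr0.
  move: aB; rewrite notin_labels_cat => /andP[? ?].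
  by rewrite big_nil addr0 !mulr0 addr0 (Efull_casimir rel).
have BE : B = al ++ be ++ t :: ga by rewrite /B cat_rcons.
rewrite BE in aB BL vB uB *.
have [P PE E] := IH (t :: ga) aB BL vB uB.
have := Efull_step rel f0 aB uL BL vB => /(canRL (subrK _)) => S.
(* The new pairs have [t] as the later end; symmetry of [kappa] supplies the opposite order in the
   doubled sum. *)
exists (P + \sum_(s <- be | s.1 != t.1) kappa L (al ++ be ++ t :: ga) s t).
  have L1 s : s \in be -> s.1 != a.
    by move=> sb; apply: notin_label aB _; rewrite !mem_cat sb orbT.
  have ta : t.1 != a by apply: notin_label aB _; rewrite !mem_cat mem_head !orbT.
  rewrite cat_rcons addrACA PE big_rcons /= big_rcons /= eqxx /=.
  under [in RHS]eq_bigr do rewrite big_rcons /=.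
  have -> : \sum_(s <- be | s.1 != t.1) kappa L (al ++ be ++ t :: ga) t s =
      \sum_(s <- be | s.1 != t.1) kappa L (al ++ be ++ t :: ga) s t.
    by rewrite big_seq_cond [RHS]big_seq_cond; apply: eq_bigr => s /andP[/L1 sa st]; apply: kappa_sym; rewrite // eq_sym.
  rewrite addr0 [X in _ = X + _]big_split /= -addrA.
  congr (_ + (_ + _)); rewrite [LHS]big_mkcond; apply: eq_bigr => s _.
  by rewrite eq_sym.
have ub : uniq (rcons be t).
  by move: uB; rewrite -cat_rcons catA cat_uniq => /andP[]; rewrite cat_uniq => /and3P[].
rewrite -/B BE -cats1 S E cats1 sum_unpaired_rcons //.
rewrite addrCA; congr (_ + _); rewrite -!mulrDr; congr (_ * (_ * _)).
by rewrite addrACA (addrC (if _ then _ else _)) [X in _ + X]addrC.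
Qed.
End Cancel.

(** * The weight system as a sum over the letters of the chords *)

Definition word (D : seq nat) : seq tok :=
  [seq (nth 0%N D k, index (nth 0%N D k) D != k) | k <- iota 0 (size D)].

Lemma labels_word D : labels (word D) = D.
Proof. by rewrite /labels /word -map_comp -[RHS](mkseq_nth 0%N). Qed.

Lemma count_nth_iota (D : seq nat) b :
  count (fun k => nth 0%N D k == b) (iota 0 (size D)) = count_mem b D.
Proof. by rewrite -[in RHS](mkseq_nth 0%N D) count_map; apply: eq_count. Qed.

Lemma count_labels n (w : seq tok) :
  count_mem n (labels w) = (count_mem (n, false) w + count_mem (n, true) w)%N.
Proof.
elim: w => //= -[m c] w ->; rewrite addnACA; congr addn.
by rewrite !xpair_eqE; case: c; case: (m == n).
Qed.

Lemma count_word D n b : chord_diagram D -> count_mem (n, b) (word D) = (n \in D).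
Proof.
move=> cD.
have F : count_mem (n, false) (word D) = (n \in D).
  rewrite /word count_map (@eq_in_count _ _ (fun k => (n \in D) && (k == index n D))); last first.
    move=> k; rewrite mem_iota add0n => /andP[_ kD] /=; rewrite xpair_eqE eqbF_neg negbK.
    have [<-|] := eqVneq (nth 0%N D k) n; first by rewrite mem_nth // eq_sym.
    by move=> nk; apply/esym; apply: contraNF nk => /andP[nD /eqP ->]; rewrite nth_index.
  case: (boolP (n \in D)) => nD /=; last by rewrite count_pred0.
  by rewrite -/(pred1 (index n D)) count_uniq_mem ?iota_uniq // mem_iota index_mem nD.
case: b => //.
have := count_labels n (word D); rewrite labels_word => /esym T.
move: T; rewrite F; case: (boolP (n \in D)) => nD.
  by have /eqP -> := allP cD _ nD; case.
by rewrite (count_memPn nD).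
Qed.

Lemma word_valid D : chord_diagram D -> valid (word D).
Proof.
move=> cD; have M t : (t \in word D) = (t.1 \in D).
  by case: t => n b; rewrite -has_pred1 has_count count_word //=; case: (_ \in _).
apply/andP; split; last by apply/allP => t; rewrite !M.
by apply: count_mem_uniq => -[n b]; rewrite count_word // M.
Qed.

Lemma inversions_sum (T : Type) (x0 : T) (o : pred T) (r : T -> nat) (s : seq T) :
  (\sum_(k < size s) \sum_(l < size s | [&& (k < l)%N, o (nth x0 s k), o (nth x0 s l)
      & (r (nth x0 s l) < r (nth x0 s k))%N]) 1)%N = inversions [seq r t | t <- s & o t].
Proof.
elim: s => [|x s IH]; first by rewrite big_ord0.
rewrite big_ord_recl /=.
rewrite [X in (_ + X)%N](_ : _ = inversions [seq r t | t <- s & o t]); last first.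
  rewrite -IH; apply: eq_bigr => k _; rewrite big_mkcond big_ord_recl /= add0n.
  by rewrite [RHS]big_mkcond; apply: eq_bigr => l _.
rewrite big_mkcond big_ord_recl /= add0n; case: (boolP (o x)) => ox /=; last first.
  by rewrite big1 ?add0n.
congr addn; rewrite count_map count_filter -sum1_count (big_nth x0) big_mkord [RHS]big_mkcond.
by apply: eq_bigr => l _; rewrite andbC.
Qed.

Lemma valid_oddf f w : valid w -> valid (oddf f w).
Proof.
case/andP=> uw /allP fw; apply/andP; split; first exact: filter_uniq.
by apply/allP => t; rewrite !mem_filter letter_flip odd_dual => /andP[-> /fw ->].
Qed.

Definition ext (L : seq nat) (f : nat -> 'I_4) (g : 'I_(size L) -> 'I_4) : nat -> 'I_4 :=
  fun m => if insub (index m L) is Some c then g c else f m.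

Section Bridge.
Variables (A : algType CC) (H G Qp Qm : A).
Local Notation e := (gen H G Qp Qm).

Lemma sumL_ffun L (F : (nat -> 'I_4) -> A) f : uniq L ->
  sumL L F f = \sum_(g : {ffun 'I_(size L) -> 'I_4})
     (\prod_(c < size L) (cas_coef (g c))%:~R) * F (ext f g).
Proof.
elim: L f => [|n L IH] f /=.
  move=> _; rewrite (big_pred1 [ffun=> ord0]) => [|g]; last first.
    by apply/esym/eqP/ffunP => -[].
  rewrite big_ord0 mul1r; congr F; apply: functional_extensionality => m.
  by rewrite /ext; case: insubP => // -[].
case/andP=> nL uL.
pose h (p : 'I_4 * {ffun 'I_(size L) -> 'I_4}) : {ffun 'I_(size L).+1 -> 'I_4} :=
  [ffun c => if unlift ord0 c is Some c' then p.2 c' else p.1].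
pose h' (g : {ffun 'I_(size L).+1 -> 'I_4}) : 'I_4 * {ffun 'I_(size L) -> 'I_4} :=
  (g ord0, [ffun c => g (lift ord0 c)]).
have hK : cancel h h'.
  move=> [i g]; rewrite /h' /h ffunE unlift_none /=; congr (_, _).
  by apply/ffunP => c; rewrite !ffunE liftK.
have hK' : cancel h' h.
  move=> g; apply/ffunP => c; rewrite ffunE /h' /=.
  by case: unliftP => [c' ->|->]; rewrite ?ffunE.
rewrite (reindex h) /=; last by exists h' => x _; [apply: hK|apply: hK'].
rewrite -(pair_bigA _ (fun i g => \prod_(c < (size L).+1) (cas_coef (h (i, g) c))%:~R * F (ext (L := n :: L) f (h (i, g))))) /=.
apply: eq_bigr => i _; rewrite IH // mulr_sumr; apply: eq_bigr => g _.
rewrite big_ord_recl ffunE unlift_none /= !mulrA; congr (_ * _ * _).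
  by apply: eq_bigr => c _; rewrite ffunE liftK.
congr F; apply: functional_extensionality => m; rewrite /ext /=.
have [<-|nm] := eqVneq n m.
  rewrite (memNindex nL) insubF ?ltnn // updE insubT ffunE.
  by case: unliftP => // j /(congr1 val).
case: insubP => [c cL cE|]; last first.
  by rewrite -leqNgt => Lm; rewrite insubF ?ltnNge ?ltnS ?Lm // updN // eq_sym.
rewrite insubT ffunE; case: unliftP => [j /(congr1 val) /= E|/(congr1 val) //].
by congr (g _); apply: val_inj; rewrite cE; case: E.
Qed.

Lemma prod_Cc0 n (f : {ffun 'I_n -> 'I_4 * 'I_4}) (c : 'I_n) : (f c).2 != dual (f c).1 ->
  \prod_(d < n) (Cc (f d).1 (f d).2)%:~R = 0 :> A.
Proof.
move=> fc; rewrite -(rmorph_prod (@intmul A 1)) (bigD1 c) //=.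
rewrite (_ : Cc (f c).1 (f c).2 = 0) ?mul0r //.
by case: (f c) fc => i j /=; case: (ord4P i) => ->; case: (ord4P j) => ->.
Qed.


(** Index pairs that are not dual have coefficient 0, which collapses the sum to one letter per
    chord; [f] is irrelevant because every chord is summed over. *)
Lemma W_sumL D f : chord_diagram D -> W e D = sumL (undup D) (fun g => term H G Qp Qm g (word D)) f.
Proof.
move=> cD; rewrite sumL_ffun ?undup_uniq // /W.
set L := undup D.
pose P (F : {ffun 'I_(size L) -> 'I_4 * 'I_4}) := [forall c, (F c).2 == dual (F c).1].
rewrite (bigID P) /= [X in _ + X]big1 ?addr0; last first.
  by move=> F /forallPn[c Fc]; rewrite (prod_Cc0 Fc) !mul0r.
pose h (g : {ffun 'I_(size L) -> 'I_4}) : {ffun 'I_(size L) -> 'I_4 * 'I_4} := [ffun c => (g c, dual (g c))].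
pose h' (F : {ffun 'I_(size L) -> 'I_4 * 'I_4}) : {ffun 'I_(size L) -> 'I_4} := [ffun c => (F c).1].
rewrite (reindex_onto h h') /=; last first.
  move=> F /forallP PF; apply/ffunP => c; rewrite !ffunE.
  by rewrite -(eqP (PF c)) -surjective_pairing.
apply: eq_big => [g|g _].
  apply/andP; split; first by apply/forallP => c; rewrite ffunE.
  by apply/eqP/ffunP => c; rewrite !ffunE.
rewrite -mulrA; congr (_ * _); first by apply: eq_bigr => c _; rewrite ffunE.
set x := fun k => letter (ext (L := L) f g) (nth 0%N D k, index (nth 0%N D k) D != k).
have xE k : (k < size D)%N ->
    (if index (nth 0%N D k) D != k
     then (odflt (ord0, ord0) (omap (h g) (insub (index (nth 0%N D k) L)))).2
     else (odflt (ord0, ord0) (omap (h g) (insub (index (nth 0%N D k) L)))).1) = x k.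
  move=> kD; rewrite /x /letter /ext /=.
  have iL : (index (nth 0%N D k) L < size L)%N by rewrite index_mem mem_undup mem_nth.
  by rewrite insubT /= ffunE.
congr (_ * _); last first.
  rewrite /wprod /word big_map; under eq_bigr => k _ do rewrite xE //.
  by rewrite -(big_mkord xpredT (fun k => e (x k))) /index_iota subn0.
rewrite -signr_odd; congr (_ ^+ nat_of_bool _).
pose r k := ((index (nth 0%N D k) L).*2 + (index (nth 0%N D k) D != k))%N.
have vO : valid (oddf (ext (L := L) f g) (word D)) by apply/valid_oddf/word_valid.
(* [W] numbers chords by their index in [undup D], whereas [koszul] compares the labels
   themselves. *)
rewrite -(koszul_relabel (rho := index^~ L) vO); last first.
  move=> m n mw nw /=; apply: (index_inj 0%N); rewrite /L mem_undup -(labels_word D).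
    by case/labelsP: mw => b; rewrite mem_filter => /andP[_ ?]; apply/labelsP; exists b.
  by case/labelsP: nw => b; rewrite mem_filter => /andP[_ ?]; apply/labelsP; exists b.
rewrite /koszul /oddf /word filter_map -!map_comp.
have := inversions_sum 0%N (fun k => odd_idx (x k)) r (iota 0 (size D)); rewrite size_iota.
rewrite (_ : inversions _ = inversions [seq (key \o ((fun t : tok => (index t.1 L, t.2)) \o (fun k => (nth 0%N D k, index (nth 0%N D k) D != k)))) k
   | k <- iota 0 (size D) & odd_idx (x k)]) // => <-.
congr odd; apply: eq_bigr => k _; apply: eq_bigl => l.
by rewrite !xE // !nth_iota.
Qed.

End Bridge.

(** * Independence of flags and labels *)

Definition flipn n (w : seq tok) := [seq if u.1 == n then flip u else u | u <- w].
Definition twist (h : pred nat) (w : seq tok) : seq tok := [seq (u.1, u.2 (+) h u.1) | u <- w].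
Definition relab (rho : nat -> nat) (w : seq tok) : seq tok := [seq (rho u.1, u.2) | u <- w].

Lemma flipn_absent n w : n \notin labels w -> flipn n w = w.
Proof.
move=> nw; rewrite -[RHS]map_id; apply/eq_in_map => u uw.
by rewrite (negPf (notin_label nw uw)).
Qed.

Lemma flipn_split c n al be ga :
  n \notin labels al -> n \notin labels be -> n \notin labels ga ->
  flipn n (al ++ (n, c) :: be ++ (n, ~~ c) :: ga) = al ++ (n, ~~ c) :: be ++ (n, c) :: ga.
Proof.
move=> na nb ng; rewrite /flipn !(map_cat, map_cons) /= eqxx /flip /= negbK.
by rewrite -!/(flipn _ _) !flipn_absent.
Qed.

Lemma valid_chord_diagram w : valid w -> chord_diagram (labels w).
Proof.
case/andP=> uw /allP fw; apply/allP => _ /mapP[t tw ->].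
have tw' := fw _ tw; rewrite count_labels !count_uniq_mem //.
by case: t tw tw' => n [] /=; rewrite /flip /= => -> ->.
Qed.

Lemma valid_relab rho w : injective rho -> valid w -> valid (relab rho w).
Proof.
move=> ir /andP[uw /allP fw]; apply/andP; split.
  by rewrite map_inj_uniq // => -[m b] [n c] /= [/ir -> ->].
apply/allP => _ /mapP[u uw' ->]; rewrite /flip /=.
by apply/mapP; exists (flip u); rewrite ?fw.
Qed.

Lemma valid_twist h w : valid w -> valid (twist h w).
Proof.
move=> /andP[uw /allP fw]; apply/andP; split.
  by rewrite map_inj_uniq // => -[m b] [n c] /= [-> /addIb ->].
apply/allP => _ /mapP[u uw' ->]; rewrite /flip /=.
by apply/mapP; exists (flip u); rewrite ?fw //= addNb.
Qed.

Lemma index_labels n w : index n (labels w) = minn (index (n, false) w) (index (n, true) w).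
Proof.
elim: w => //= -[m c] w ->; rewrite !xpair_eqE.
by case: (m == n) => /=; case: c; rewrite /= ?min0n ?minn0 // minnSS.
Qed.

Lemma minn_neq k j : j != k -> (minn k j != k) = (j < k)%N.
Proof. by rewrite /minn; case: ltngtP => //; rewrite ?eqxx // => /ltn_eqF ->. Qed.

(** Forgetting the flags and restoring them by position reverses exactly the chords whose [true] end
    comes first. *)
Lemma word_labels w : valid w ->
  word (labels w) = twist (fun n => (index (n, true) w < index (n, false) w)%N) w.
Proof.
case/andP=> uw /allP fw; pose x0 : tok := (0%N, false).
set h := (fun n => _ < _)%N; rewrite /twist -[in RHS](mkseq_nth x0 w) -map_comp /word /labels size_map.
apply/eq_in_map => k; rewrite mem_iota add0n => /andP[_ kw] /=.
rewrite (nth_map x0) // -/(labels w) index_labels.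
have uk : nth x0 w k \in w by apply: mem_nth.
have ik : index (nth x0 w k) w = k by apply: index_uniq.
have fk := fw _ uk.
have ne : index (flip (nth x0 w k)) w != k.
  by rewrite -{2}ik; apply: contraTneq isT => /(index_inj x0 fk uk) /eqP; rewrite flip_neq.
case: (nth x0 w k) ik ne => n [] /=; rewrite /flip /= => E ne; congr (_, _); rewrite ?E.
  by rewrite /h ?E minnC minn_neq // -leqNgt ltn_neqAle ne.
by rewrite /h ?E minn_neq.
Qed.

Section Invariance.
Variables (A : algType CC) (H G Qp Qm : A).
Local Notation e := (gen H G Qp Qm).
Local Notation term := (term H G Qp Qm).

Lemma sumL_flipn L n w f : uniq L -> n \in L -> valid w ->
  sumL L (term^~ w) f = sumL L (term^~ (flipn n w)) f.
Proof.
move=> uL nL vw; have [nw|nw] := boolP (n \in labels w); last by rewrite flipn_absent.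
case/labelsP: nw => b tw; have [c [al [be [ga [-> /= na nb ng _]]]]] := valid_split vw tw.
rewrite flipn_split // !(sumL_rml _ _ uL nL); apply: sumL_ext => g _.
rewrite [RHS](reindex_inj (inv_inj dualK)); apply: eq_bigr => i _.
exact: term_flip.
Qed.

Lemma sumL_twist L (F : seq nat) w f : uniq L -> uniq F -> {subset F <= L} -> valid w ->
  sumL L (term^~ w) f = sumL L (term^~ (twist (mem F) w)) f.
Proof.
move=> uL; elim: F => [|n F IH] /= uF FL vw.
  by rewrite /twist (eq_map (g := id)) ?map_id // => -[m b] /=; rewrite in_nil addbF.
case/andP: uF => nF uF.
rewrite IH // => [|m mF]; last by apply: FL; rewrite inE mF orbT.
rewrite (@sumL_flipn _ n) // ?valid_twist //; last by apply: FL; rewrite mem_head.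
apply: sumL_ext => g _; congr (term _ _); rewrite /flipn /twist -map_comp.
apply: eq_map => -[m b] /=.
by rewrite in_cons; case: eqVneq => [->|//]; rewrite /flip /= (negPf nF) addbF addbT.
Qed.

(** Since reversing a chord preserves the sum, any valid word evaluates its diagram, whatever its
    flags and the order of [L]. *)
Lemma W_valid L w f : uniq L -> L =i labels w -> valid w ->
  W e (labels w) = sumL L (term^~ w) f.
Proof.
move=> uL Lw vw; rewrite (W_sumL _ _ _ _ f) ?valid_chord_diagram // word_labels //.
have uU : uniq (undup (labels w)) by apply: undup_uniq.
rewrite (@sumL_perm _ _ L) //; last by apply: uniq_perm => // x; rewrite mem_undup Lw.
set h := (fun n => _ < _)%N.
rewrite (@sumL_twist L [seq n <- L | h n] w) ?filter_uniq //; last first.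
  by move=> n; rewrite mem_filter => /andP[].
apply: sumL_ext => g _; congr (term _ _); apply/eq_in_map => u uw /=.
by rewrite mem_filter Lw (map_f fst uw) andbT.
Qed.

Lemma sumL_map rho L (F : (nat -> 'I_4) -> A) f : injective rho ->
  sumL (map rho L) (fun g => F (g \o rho)) f = sumL L F (f \o rho).
Proof.
move=> ir; elim: L f => //= n L IH f; apply: eq_bigr => i _; rewrite IH.
congr (_ * sumL _ _ _); apply: functional_extensionality => m /=.
by rewrite /upd (inj_eq ir).
Qed.

Lemma term_relab rho g w : injective rho -> valid w -> term g (relab rho w) = term (g \o rho) w.
Proof.
move=> ir vw; rewrite /term /wprod /relab big_map; congr (_ * _).
rewrite /oddf filter_map; congr (_ ^+ nat_of_bool _).
by rewrite -(koszul_relabel (rho := rho) (valid_oddf (g \o rho) vw)) // => x y _ _; apply: ir.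
Qed.

Lemma W_relab rho w : injective rho -> valid w -> W e (map rho (labels w)) = W e (labels w).
Proof.
move=> ir vw; pose f : nat -> 'I_4 := fun=> ord0.
have uU : uniq (undup (labels w)) by apply: undup_uniq.
rewrite (@W_valid (undup (labels w)) w f) // => [|x]; last by rewrite mem_undup.
have -> : map rho (labels w) = labels (relab rho w) by rewrite /labels -!map_comp.
rewrite (@W_valid (map rho (undup (labels w))) _ f) ?map_inj_uniq // ?valid_relab //; last first.
  have -> : labels (relab rho w) = map rho (labels w) by rewrite /labels -!map_comp.
  by move=> x; apply: eq_mem_map => y; rewrite mem_undup.
rewrite -[in RHS](sumL_map (rho := rho) _ _ f) //.
by apply: sumL_ext => g _; apply: term_relab.
Qed.

Variables (a : nat) (f0 : nat -> 'I_4).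
Local Notation V1 := (EvI H G Qp Qm a f0 iG).
Local Notation V3 := (EvI H G Qp Qm a f0 iM).
Local Notation Efull := (Efull H G Qp Qm a f0).

Lemma Efull_sumL L w : a \notin L -> sumL (a :: L) (term^~ w) f0 = Efull L w.
Proof. by move=> aL /=; apply: eq_bigr => i _; rewrite sumL_upd. Qed.

Lemma Efull_flipn L w : valid w -> a \in labels w ->
  Efull L w = V1 L w + V1 L (flipn a w) + (V3 L w + V3 L (flipn a w)).
Proof.
move=> vw /labelsP[b tw]; have [c [al [be [ga [-> /= na nb ng _]]]]] := valid_split vw tw.
by rewrite flipn_split // EfullE.
Qed.

End Invariance.

(** * Chords crossing a given chord *)

Lemma fresh_notin D : fresh D \notin D.
Proof.
suff le x : x \in D -> (x <= foldr maxn 0%N D)%N.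
  by apply/negP => /le; rewrite /fresh ltnn.
elim: D => //= y D IH; rewrite inE leq_max => /orP[/eqP ->|/IH ->]; first by rewrite leqnn.
by rewrite orbT.
Qed.

Section CutWord.
Variables (a : nat) (P M R : seq nat).
Hypotheses (aP : a \notin P) (aM : a \notin M).
Let D := P ++ a :: M ++ a :: R.

Lemma on_leftE k : on_left D a k = (size P < k < (size P).+1 + size M)%N.
Proof.
have p1 : index a D = size P by rewrite index_cat (negPf aP) /= eqxx addn0.
rewrite /on_left /pos1 /pos2 p1; congr (_ && (_ < _ + _)%N).
rewrite /D -cat_rcons drop_size_cat ?size_rcons //.
by rewrite index_cat (negPf aM) /= eqxx addn0.
Qed.

Lemma crosses_count b : b != a -> crosses D a b = (count_mem b M == 1%N).
Proof.
move=> ba; rewrite /crosses ba /=; congr (_ == _).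
(* The outer two blocks contain the positions of [a] itself, which belong to neither arc; only the
   middle block counts. *)
have -> : iota 0 (size D) = iota 0 (size P).+1 ++ iota (size P).+1 (size M) ++
    iota ((size P).+1 + size M) (size R).+1.
  have -> : size D = ((size P).+1 + (size M + (size R).+1))%N.
    by rewrite /D size_cat /= size_cat /= addnS addSn.
  by rewrite !iotaD add0n.
rewrite !count_cat [X in (X + _)%N](_ : _ = 0%N); last first.
  apply/eqP; rewrite -leqn0 leqNgt -has_count; apply/hasPn => k; rewrite mem_iota add0n ltnS.
  by move=> /andP[_ kP]; rewrite on_leftE ltnNge kP andbF.
rewrite [X in (_ + (_ + X))%N](_ : _ = 0%N); last first.
  apply/eqP; rewrite -leqn0 leqNgt -has_count; apply/hasPn => k; rewrite mem_iota.
  by case/andP=> kM _; rewrite on_leftE [(k < _)%N]ltnNge kM !andbF.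
rewrite add0n addn0 -count_nth_iota -[in LHS](addn0 (size P).+1) iotaDl count_map.
apply: eq_in_count => k; rewrite mem_iota add0n => /andP[_ kM] /=.
rewrite on_leftE ltn_add2l kM ltnS leq_addr !andbT.
rewrite /D -cat_rcons nth_cat size_rcons ltnNge leq_addr /= addKn.
by rewrite nth_cat kM.
Qed.

End CutWord.

(** * Joining two chords, expressed by marks *)

Lemma pmap_zip_cat (T U : Type) (F : nat * T -> option U) o (v w : seq T) :
  pmap F (zip (iota o (size (v ++ w))) (v ++ w)) =
  pmap F (zip (iota o (size v)) v) ++ pmap F (zip (iota (o + size v) (size w)) w).
Proof. by rewrite size_cat iotaD zip_cat ?size_iota // pmap_cat. Qed.

Definition joinF (D : seq nat) (a bi bj : nat) (li lj : bool) (kx : nat * nat) : option nat :=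
  let: (k, x) := kx in
  if x == a then None
  else if x == bi then (if on_left D a k == li then Some (fresh D) else None)
  else if x == bj then (if on_left D a k == lj then Some (fresh D) else None)
  else Some x.

(** Within one arc only one end of each crossing chord can occur, so the position test of [join]
    amounts to choosing that end. The new chord is called [a] in the word of marks and [rho] renames
    it to the fresh label. *)
Lemma join_segment D a s t (li lj lf : bool) o (v : seq tok) (rho : nat -> nat) :
  s.1 != t.1 -> s.1 != a -> t.1 != a -> rho a = fresh D ->
  (forall k, (o <= k < o + size v)%N -> on_left D a k = lf) ->
  {in v, forall u, [/\ u.1 != a, rho u.1 = u.1,
     u.1 = s.1 -> u = if lf then s else flip s & u.1 = t.1 -> u = if lf then t else flip t]} ->
  pmap (joinF D a s.1 t.1 li lj) (zip (iota o (size v)) (labels v)) =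
  map rho (labels (put (if li then s else flip s) (a, false)
                       (put (if lj then t else flip t) (a, true) v))).
Proof.
move=> st sa ta ra; elim: v o => [|u v IH] o //= Ho Hv.
have [ua ru us ut] := Hv _ (mem_head _ _).
have lo : on_left D a o = lf by apply: Ho; rewrite leqnn -addn1 leq_add2l.
have neq (y z : tok) : y.1 != z.1 -> (y == z) = false /\ (y == flip z) = false.
  by move=> yz; split; apply: contraNF yz => /eqP ->.
rewrite (negPf ua) lo put_cons.
set x := if li then s else flip s; set y := if lj then t else flip t.
have x1 : x.1 = s.1 by rewrite /x; case: (li).
have y1 : y.1 = t.1 by rewrite /y; case: (lj).
have {}IH : pmap (joinF D a s.1 t.1 li lj) (zip (iota o.+1 (size v)) (labels v)) =
    map rho (labels (put x (a, false) (put y (a, true) v))).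
  by apply: IH => [k /andP[ok kv]|z zv]; [apply: Ho; rewrite ltnW //= addnS -addSn|apply: Hv; rewrite inE zv orbT].
have [es|ns] := eqVneq u.1 s.1.
  have [-> ->] : (u == y) = false /\ (u == flip y) = false by apply: neq; rewrite es y1.
  have E : (u == x) = (lf == li) /\ (u == flip x) = (lf != li).
    by rewrite (us es) /x; case: (lf); case: (li); rewrite ?flipK ?eqxx ?flip_neq // eq_sym flip_neq.
  rewrite /= put_cons E.1 E.2; case: (lf == li) => /=; rewrite IH // ra //.
have [et|nt] := eqVneq u.1 t.1.
  have E : (u == y) = (lf == lj) /\ (u == flip y) = (lf != lj).
    by rewrite (ut et) /y; case: (lf); case: (lj); rewrite ?flipK ?eqxx ?flip_neq // eq_sym flip_neq.
  rewrite E.1 E.2; case: (lf == lj) => /=; rewrite IH //.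
  have [E1 E2] : ((a, true) == x) = false /\ ((a, true) == flip x) = false.
    by apply: neq; rewrite /= x1 eq_sym.
  by rewrite put_cons E1 E2 /= ra.
have [-> ->] : (u == y) = false /\ (u == flip y) = false by apply: neq; rewrite y1.
have [E1 E2] : (u == x) = false /\ (u == flip x) = false by apply: neq; rewrite x1.
by rewrite /= put_cons E1 E2 /= ru IH.
Qed.

Lemma flipn_put a x c w : c.1 = a -> x.1 != a ->
  flipn a (put x c w) = put x (flip c) (flipn a w).
Proof.
move=> ca xa; elim: w => //= u w IH; rewrite !put_cons /flipn map_cat -!/(flipn _ _) IH.
congr (_ ++ _).
have [->|ux] := eqVneq u x; first by rewrite (negPf xa) eqxx /= ca eqxx.
have [->|uf] := eqVneq u (flip x); first by rewrite (negPf xa) eqxx flip_neq.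
case: (boolP (u.1 == a)) => ua /=; last by rewrite (negPf ux) (negPf uf) /= (negPf ua).
have [E1 E2] : (flip u == x) = false /\ (flip u == flip x) = false.
  split; first by apply: contraNF xa => /eqP <-.
  by apply: contraNF xa => /eqP E; rewrite -[x.1]/((flip x).1) -E.
by rewrite E1 E2 /= ua.
Qed.

Lemma filter_put (d : tok) x c w : c != d -> x.1 != d.1 ->
  [seq u <- put x c w | u != d] = put x c [seq u <- w | u != d].
Proof.
move=> cd xd; have xn : x != d by apply: contraNneq xd => ->.
have fn : flip x != d by apply: contraNneq xd => <-.
elim: w => //= u w IH; rewrite put_cons filter_cat IH.
have [->|ux] := eqVneq u x; first by rewrite xn put_cons eqxx /= cd.
have [->|uf] := eqVneq u (flip x); first by rewrite fn put_cons eqxx flip_neq.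
by case: ifP => ud; rewrite /= ud // put_cons (negPf ux) (negPf uf).
Qed.

Lemma filter_put_self t (c : tok) w : c.1 \notin labels w ->
  [seq u <- put t c w | u != c] = rmt t.1 w.
Proof.
elim: w => //= u w IH; rewrite inE negb_or => /andP[cu cw].
rewrite put_cons filter_cat IH //.
have [->|ut] := eqVneq u t; first by rewrite /= !eqxx.
have [->|uf] := eqVneq u (flip t); first by rewrite /= eqxx.
have uc : u != c by apply: contraNneq cu => ->.
rewrite /= uc ifT //; apply: contraNneq uf => uE.
by have [E|->] := tok_label_eq uE; first by rewrite E eqxx in ut.
Qed.

Lemma put2_mem a x y B n : valid B -> x \in B -> y \in B -> x.1 != y.1 -> a \notin labels B ->
  (n \in labels (put x (a, false) (put y (a, true) B))) =
  (n == a) || [&& n \in labels B, n != x.1 & n != y.1].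
Proof.
move=> vB xB yB xy aB; have xp : x \in put y (a, true) B by rewrite mem_put xB xy orbT.
apply/idP/idP => [/labelsP[b]|].
  rewrite mem_put xp /= => /orP[/eqP[-> _]|/andP[]]; first by rewrite eqxx.
  rewrite mem_put yB /= => /orP[/eqP[-> _] //|/andP[nB ny] nx]; first by rewrite eqxx.
  by rewrite nx ny (map_f fst nB) orbT.
case/orP=> [/eqP ->|/and3P[/labelsP[b nB] nx ny]].
  by apply/labelsP; exists false; rewrite mem_put xp eqxx.
by apply/labelsP; exists b; rewrite !mem_put nB nx ny !orbT.
Qed.

Lemma put2_valid a x y B : valid B -> x \in B -> y \in B -> x.1 != y.1 -> a \notin labels B ->
  valid (put x (a, false) (put y (a, true) B)).
Proof.
move=> vB xB yB xy aB; have xp : x \in put y (a, true) B by rewrite mem_put xB xy orbT.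
have ax : a != x.1 by apply: contraNneq aB => ->; apply: map_f.
have nB b : (a, b) \notin B by apply: contra aB => H; apply/labelsP; exists b.
apply/andP; split.
  apply: put_uniq; first by apply: put_uniq => //; case/andP: vB.
  by rewrite mem_put negb_or !negb_and nB /= !orbT.
apply/allP => u; rewrite !(mem_put x) xp !(mem_put y) yB /= => /orP[/eqP ->|/andP[/orP[/eqP ->|/andP[uB uy]] ux]].
- by rewrite /flip /= eqxx ax orbT.
- by rewrite /flip /= eqxx.
by rewrite ux uy (valid_flip vB uB) !orbT.
Qed.

Lemma mem_unpaired_labels n w : uniq w ->
  (n \in labels (unpaired w)) = (count_mem n (labels w) == 1%N).
Proof.
move=> uw; rewrite count_labels !count_uniq_mem //.
apply/labelsP/idP => [[b]|].
  by rewrite mem_filter /flip /=; case: b => /= /andP[/negPf -> ->].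
case H0 : ((n, false) \in w); case H1 : ((n, true) \in w) => //= _.
  by exists false; rewrite mem_filter /flip /= H0 H1.
by exists true; rewrite mem_filter /flip /= H0 H1.
Qed.

Lemma labels_unpaired_uniq w : uniq w -> uniq (labels (unpaired w)).
Proof.
move=> uw; rewrite map_inj_in_uniq ?filter_uniq // => x y.
rewrite !mem_filter => /andP[fx xw] /andP[fy yw] xy.
by have [//|E] := tok_label_eq xy; rewrite E in xw; rewrite xw in fy.
Qed.

Lemma labels_rmt n w : labels (rmt n w) = [seq m <- labels w | m != n].
Proof. by rewrite /labels filter_map. Qed.

(** Each [g] belongs to one end and occurs in two joins, one with each end of the other chord; these
    have opposite signs. *)
Lemma lone_cancel (V : zmodType) (k1 k2 k3 k4 g1 g2 g3 g4 : V) :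
  k1 - k2 - k3 + k4 =
  - (k3 + (g1 + g4) + (k2 + (g3 + g2)) - (k1 + (g1 + g2)) - (k4 + (g3 + g4))).
Proof.
rewrite !opprD !opprK !addrA.
rewrite [RHS](ACl ((7*4*1*10)*((2*8)*(3*12)*(5*11)*(6*9)))) /=.
by rewrite !addNr !addr0 addrAC.
Qed.

(** * Identification with the diagrams of the recursion *)

Section Final.
Variables (A : algType CC) (H G Qp Qm : A).
Hypothesis rel : gl11_rel H G Qp Qm.
Variables (a : nat) (al be ga : seq tok).

Let f0 : nat -> 'I_4 := fun=> ord0.
Let B := al ++ be ++ ga.
Let D := labels al ++ a :: labels be ++ a :: labels ga.
Let L := rml a (undup D).

Hypotheses (vB : valid B) (aB : a \notin labels B).

Local Notation e := (gen H G Qp Qm).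
Local Notation Ev := (Ev H G Qp Qm f0).
Local Notation V1 := (EvI H G Qp Qm a f0 iG).
Local Notation V3 := (EvI H G Qp Qm a f0 iM).
Local Notation Efull := (Efull H G Qp Qm a f0).
Local Notation K := (K H G Qp Qm a f0).
Local Notation kappa := (kappa H G Qp Qm a f0).
Local Notation a0 := (a, false).
Local Notation a1 := (a, true).

Let uB : uniq B. Proof. by case/andP: vB. Qed.
Let uL : uniq L. Proof. by rewrite filter_uniq ?undup_uniq. Qed.
Let aL : a \notin L. Proof. by rewrite mem_rml eqxx. Qed.

Let mem_L n : (n \in L) = (n \in labels B).
Proof.
rewrite mem_rml mem_undup /D /B /labels !map_cat !(mem_cat, inE).
have [->|] := eqVneq n a => //=.
by move: aB; rewrite /labels !map_cat !mem_cat => /negPf ->.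
Qed.

Let BL : {in B, forall s, s.1 \in L}.
Proof. by move=> s sB; rewrite mem_L (map_f fst). Qed.

Let notaB b : (a, b) \notin B.
Proof. by apply: contra aB => H'; apply/labelsP; exists b. Qed.

Let label_neq x : x \in B -> x.1 != a.
Proof. by apply: notin_label. Qed.

Let ube : uniq be.
Proof. by move: uB; rewrite /B !cat_uniq => /and3P[_ _ /andP[]]. Qed.

Lemma del1E : del D [:: a] = labels B.
Proof.
have F v : a \notin labels v -> [seq x <- labels v | x \notin [:: a]] = labels v.
  by move=> av; apply/all_filterP/allP => x xv; rewrite inE; apply: contraNneq av => <-.
move: aB; rewrite /B !notin_labels_cat => /and3P[a1' a2 a3].
rewrite /del /D filter_cat /= inE eqxx /= filter_cat /= inE eqxx /= !F //.
by rewrite /labels !map_cat.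
Qed.

Lemma del2E n : del D [:: a; n] = labels (rmt n B).
Proof.
have -> : del D [:: a; n] = [seq x <- del D [:: a] | x != n].
  rewrite /del -filter_predI; apply: eq_filter => x /=.
  by rewrite !inE negb_or andbC.
by rewrite del1E labels_rmt.
Qed.

Lemma W_del1 : W e (del D [:: a]) = Ev L B.
Proof. by rewrite del1E; apply: W_valid => // n; rewrite mem_L. Qed.

Lemma W_del2 n : W e (del D [:: a; n]) = Ev (rml n L) (rmt n B).
Proof.
rewrite del2E; apply: W_valid; first exact: filter_uniq.
  by move=> m; rewrite mem_rml mem_L labels_rmt mem_filter.
apply/andP; split; first exact: filter_uniq.
by apply/allP => x; rewrite !mem_filter /= => /andP[-> /(valid_flip vB) ->].
Qed.

(** A chord crosses [a] when exactly one of its ends is in [be]. The two lists may be ordered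
    differently, hence only a permutation. *)
Lemma perm_crossing : perm_eq (labels (unpaired be)) (crossing D a).
Proof.
apply: uniq_perm; first exact: labels_unpaired_uniq.
  by rewrite filter_uniq ?undup_uniq.
move: aB; rewrite /B !notin_labels_cat => /and3P[a1' a2 a3].
move=> n; rewrite mem_unpaired_labels // mem_filter mem_undup.
have [->|na] := eqVneq n a.
  by rewrite /crosses eqxx /= (count_memPn a2).
rewrite crosses_count //; case: eqP => //= cn; apply/esym.
have : n \in labels be by rewrite -has_pred1 has_count cn.
by rewrite /D mem_cat inE mem_cat => ->; rewrite !orbT.
Qed.

Lemma W_join s t (li lj : bool) : s \in unpaired be -> t \in unpaired be -> s.1 != t.1 ->
  W e (join D a s.1 t.1 li lj) =
  Efull (rml s.1 (rml t.1 L)) (put (if li then s else flip s) a0 (put (if lj then t else flip t) a1 B)).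
Proof.
move=> su tu st.
set x := if li then s else flip s; set y := if lj then t else flip t.
have inB u : u \in unpaired be -> [/\ u \in B, flip u \in B & flip u \notin be].
  rewrite mem_filter => /andP[fu ub]; have uB' : u \in B by rewrite !mem_cat ub orbT.
  by rewrite (valid_flip vB).
have [sB fsB fs] := inB _ su; have [tB ftB ft] := inB _ tu.
have xB : x \in B by rewrite /x; case: (li).
have yB : y \in B by rewrite /y; case: (lj).
have x1 : x.1 = s.1 by rewrite /x; case: (li).
have y1 : y.1 = t.1 by rewrite /y; case: (lj).
have xy : x.1 != y.1 by rewrite x1 y1.
have vw := put2_valid vB xB yB xy aB.
set w := put x a0 _ in vw *.
have aL2 : a \notin rml s.1 (rml t.1 L) by rewrite (mem_rml s.1) (mem_rml t.1) (negPf aL) !andbF.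
rewrite -Efull_sumL //.
rewrite -(@W_valid _ H G Qp Qm (a :: rml s.1 (rml t.1 L)) w f0) //; first last.
- by move=> n; rewrite inE (mem_rml s.1) (mem_rml t.1) mem_L put2_mem // x1 y1; congr orb; rewrite andbA andbC.
- by rewrite /= aL2 /rml; do 2!apply: filter_uniq; exact: uL.
pose z := fresh D.
have aD : a \in D by rewrite /D mem_cat mem_head orbT.
have zD : z \notin D by apply: fresh_notin.
have az : a != z by apply: contraNneq zD => <-.
(* Swapping [a] with the fresh label is injective on all labels, as invariance under renaming
   requires. *)
pose rho m := if m == a then z else if m == z then a else m.
have rhoK : involutive rho.
  move=> m; rewrite /rho; have [->|ma] := eqVneq m a; first by rewrite eq_sym (negPf az) eqxx.
  have [->|mz] := eqVneq m z; first by rewrite eqxx.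
  by rewrite (negPf ma) (negPf mz).
rewrite -(W_relab _ _ _ _ (inv_inj rhoK)) //; congr (W _ _).
have ra : rho a = fresh D by rewrite /rho eqxx.
have sa := label_neq sB; have ta := label_neq tB.
have rv u : u \in B -> rho u.1 = u.1.
  move=> uB'; rewrite /rho (negPf (label_neq uB')) ifF //.
  apply: contraNF zD => /eqP <-; have := BL uB'.
  by rewrite mem_rml mem_undup => /andP[].
have a_al : a \notin labels al by move: aB; rewrite /B !notin_labels_cat => /and3P[].
have a_be : a \notin labels be by move: aB; rewrite /B !notin_labels_cat => /and3P[].
have inbe u v : u \in unpaired be -> v \in be -> v.1 = u.1 -> v = u.
  by move=> uu vb vu; have [//|E] := tok_label_eq vu; have [_ _] := inB _ uu; rewrite -E vb.
have out u v : u \in unpaired be -> v \in al ++ ga -> v.1 = u.1 -> v = flip u.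
  move=> uu vo vu; have [E|//] := tok_label_eq vu.
  move: uu uB; rewrite mem_filter -E => /andP[_ vb].
  rewrite /B (perm_uniq (permEl (perm_catCA al be ga))) cat_uniq => /and3P[_ /hasPn H' _].
  by move: (H' _ vo); rewrite /= vb.
have JS lf o (v : seq tok) := @join_segment D a s t li lj lf o v rho st sa ta ra.
have put_cat u c v v' : put u c (v ++ v') = put u c v ++ put u c v' by apply: sub_cat.
have D1 : size (labels al) = size al by rewrite size_map.
have D2 : size (labels be) = size be by rewrite size_map.
have D3 : size (labels ga) = size ga by rewrite size_map.
have OL k : on_left D a k = (size al < k < (size al).+1 + size be)%N by rewrite on_leftE // D1 D2.
have -> : join D a s.1 t.1 li lj = pmap (joinF D a s.1 t.1 li lj) (zip (iota 0 (size D)) D) by [].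
have -> : zip (iota 0 (size D)) D = zip (iota 0 (size (labels al ++ [:: a] ++ labels be ++ [:: a] ++ labels ga)))
   (labels al ++ [:: a] ++ labels be ++ [:: a] ++ labels ga) by [].
rewrite !pmap_zip_cat D1 D2 D3 /= eqxx add0n addn1 /=.
have bB (v : tok) : v \in be -> v \in B by move=> H'; rewrite !mem_cat H' orbT.
have oB (v : tok) : v \in al ++ ga -> v \in B by rewrite !mem_cat => /orP[] ->; rewrite ?orbT.
rewrite (JS false 0%N al); first last.
- move=> v va; have vo : v \in al ++ ga by rewrite mem_cat va.
  by split; rewrite ?label_neq ?rv ?oB // => vu; apply: out.
- by move=> k /andP[_ ka]; rewrite OL ltnNge ltnW ?ka.
rewrite (JS true (size al).+1 be); first last.
- by move=> v vb; split; rewrite ?label_neq ?rv ?bB // => vu; apply: inbe.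
- by move=> k; rewrite OL.
rewrite (JS false _ ga); first last.
- move=> v va; have vo : v \in al ++ ga by rewrite mem_cat va orbT.
  by split; rewrite ?label_neq ?rv ?oB // => vu; apply: out.
- by move=> k /andP[kg _]; rewrite OL [(k < _)%N]ltnNge (leq_trans (leq_addr 1 _) kg) andbF.
by rewrite /w /B !put_cat /labels !map_cat.
Qed.

(* The tensor G (x) H placed on [x] and on an end of chord [n], divided by H. *)
Definition loneG x n := V1 (rml x.1 (rml n L)) (put x a0 (rmt n B)).

Lemma EvI_H_drop L' w : uniq w -> a1 \in w -> V1 L' w = H * V1 L' [seq u <- w | u != a1].
Proof.
move=> uw aw; move: uw; case/splitPr: aw => v v' uw; rewrite (EvI_H_out rel).
congr (_ * V1 _ _); rewrite filter_cat /= eqxx.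
move: uw; rewrite (uniq_catCA v [:: a1] v') /= mem_cat negb_or => /andP[/andP[n1 n2] _].
congr (_ ++ _); apply/esym/all_filterP/allP => u uv.
  by apply: contraNneq n1 => <-.
by apply: contraNneq n2 => <-.
Qed.

(** The odd part of the joining chord is [K]; its even part has [G] at one end and the central [H]
    at the other, which is pulled out. *)
Lemma Efull_put2 x y : x \in B -> y \in B -> x.1 != y.1 ->
  Efull (rml x.1 (rml y.1 L)) (put x a0 (put y a1 B)) =
  K L B x y + (H * loneG x y.1 + H * loneG y x.1).
Proof.
move=> xB yB xy.
have vw := put2_valid vB xB yB xy aB.
have yx : y.1 != x.1 by rewrite eq_sym.
have vw' := put2_valid vB yB xB yx aB.
have [xa ya] := (label_neq xB, label_neq yB).
have al_w : a \in labels (put x a0 (put y a1 B)) by rewrite put2_mem // eqxx.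
rewrite Efull_flipn // !flipn_put // flipn_absent //= addrC; congr (_ + _).
have drop u v : u \in B -> v \in B -> u.1 != v.1 ->
    V1 (rml u.1 (rml v.1 L)) (put u a0 (put v a1 B)) = H * loneG u v.1.
  move=> uB' vB' uv; have vw2 := put2_valid vB uB' vB' uv aB.
  have [ua va] := (label_neq uB', label_neq vB').
  have a01 : a0 != a1 by rewrite xpair_eqE andbF.
  have aw : a1 \in put u a0 (put v a1 B) by rewrite mem_put; apply/orP; right; rewrite mem_put vB' eqxx /= eq_sym.
  by rewrite (EvI_H_drop _ (proj1 (andP vw2)) aw) filter_put ?filter_put_self.
rewrite drop // put_comm //= 1?eq_sym //.
by rewrite rml_comm drop.
Qed.

Definition joinW b b' (li lj : bool) : A := W e (join D a b b' li lj).

(** The left ends are [s] and [t], the right ends their flips, so the four values of [K] in [kappa]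
    are the odd parts of the four joins. A [loneG] term does not depend on which end of the other
    chord is used, and cancels. *)
Lemma kappaE s t : s \in unpaired be -> t \in unpaired be -> s.1 != t.1 ->
  kappa L B s t = - (joinW s.1 t.1 true false + joinW s.1 t.1 false true
                   - joinW s.1 t.1 true true - joinW s.1 t.1 false false).
Proof.
move=> su tu st; rewrite /joinW !W_join //=.
have inB u : u \in unpaired be -> (u \in B) && (flip u \in B).
  rewrite mem_filter => /andP[_ ub]; have uB' : u \in B by rewrite !mem_cat ub orbT.
  by rewrite uB' (valid_flip vB).
have /andP[sB fsB] := inB _ su; have /andP[tB ftB] := inB _ tu.
have E u v : u \in B -> v \in B -> u.1 = s.1 -> v.1 = t.1 ->
    Efull (rml s.1 (rml t.1 L)) (put u a0 (put v a1 B)) = K L B u v + (H * loneG u t.1 + H * loneG v s.1).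
  by move=> uB' vB' us vt; rewrite -us -vt Efull_put2 // us vt.
rewrite !E // /kappa.
move: (K L B s t) (K L B (flip s) t) (K L B s (flip t)) (K L B (flip s) (flip t)) => k1 k2 k3 k4.
move: (H * loneG s t.1) (H * loneG t s.1) (H * loneG (flip s) t.1) (H * loneG (flip t) s.1) => g1 g2 g3 g4.
exact: lone_cancel.
Qed.

End Final.

Theorem mainTheorem1 (A : algType CC) (H G Qp Qm : A)
    (rel : gl11_rel H G Qp Qm) (D : seq nat) (a : nat) :
  chord_diagram D -> a \in D ->
  let e := gen H G Qp Qm in
  let c := casimir e in
  let y := - (H * H) in
  let bs := crossing D a in
  let m := size bs in
  W e D =
    c * W e (del D [:: a])
    - y * (\sum_(i < m) W e (del D [:: a; nth 0%N bs i]))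
    + y * (\sum_(i < m) \sum_(j < m | (i < j)%N)
             (W e (join D a (nth 0%N bs i) (nth 0%N bs j) true false)
              + W e (join D a (nth 0%N bs i) (nth 0%N bs j) false true)
              - W e (join D a (nth 0%N bs i) (nth 0%N bs j) true true)
              - W e (join D a (nth 0%N bs i) (nth 0%N bs j) false false))).
Proof.
move=> cD aD e0 c y bs m.
have vT := word_valid cD.
have : a \in labels (word D) by rewrite labels_word.
case/labelsP=> b0 aT; have [d [al [be [ga [wE /= na nb ng vB]]]]] := valid_split vT aT.
have DE : D = labels al ++ a :: labels be ++ a :: labels ga.
  by rewrite -[LHS]labels_word wE /labels !(map_cat, map_cons).
pose B := al ++ be ++ ga; pose L := rml a (undup D); pose f0 : nat -> 'I_4 := fun=> ord0.
have aB : a \notin labels B by rewrite !notin_labels_cat na nb.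
have uL : uniq L by rewrite filter_uniq ?undup_uniq.
have aL : a \notin L by rewrite mem_rml eqxx.
have uB : uniq B by case/andP: vB.
have BL : {in B, forall s, s.1 \in L}.
  move=> s sB; rewrite mem_rml mem_undup (notin_label aB sB) /= DE.
  move: sB; rewrite !(mem_cat, inE) => /or3P[] /(map_f fst) sl.
  - by rewrite [_ \in labels al]sl.
  - by rewrite [_ \in labels be]sl !orbT.
  by rewrite [_ \in labels ga]sl !orbT.
have ub : uniq be by move: uB; rewrite /B !cat_uniq => /and3P[_ _ /andP[]].
have WD : W e0 D = Efull H G Qp Qm a f0 L (al ++ (a, false) :: be ++ (a, true) :: ga).
  have -> : Efull H G Qp Qm a f0 L (al ++ (a, false) :: be ++ (a, true) :: ga) =
     Efull H G Qp Qm a f0 L (word D).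
    (* Supersymmetry makes the flag [d] of the first end of [a] immaterial. *)
    by rewrite wE; case: (d) => //; rewrite -(Efull_flip H G Qp Qm f0 false).
  rewrite -Efull_sumL // (W_sumL _ _ _ _ f0) //; apply: sumL_perm; first exact: undup_uniq.
  apply: uniq_perm; rewrite ?undup_uniq //= ?aL // => x.
  by rewrite inE mem_rml mem_undup; case: eqVneq => // ->.
have [P PE E] := Efull_expand rel f0 aB uL BL vB.
have pb := perm_crossing vB aB; rewrite -DE -/bs in pb.
pose Phi b b' := W e0 (join D a b b' true false) + W e0 (join D a b b' false true)
  - W e0 (join D a b b' true true) - W e0 (join D a b b' false false).
have kE s t : s \in unpaired be -> t \in unpaired be -> s.1 != t.1 ->
    kappa H G Qp Qm a f0 L B s t = - Phi s.1 t.1.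
  by move=> su tu st; have := kappaE rel vB aB su tu st; rewrite /joinW -DE.
have inbs b : b \in bs -> exists2 s, s \in unpaired be & b = s.1.
  by rewrite -(perm_mem pb) => /mapP.
have Phi_sym : {in bs &, forall b b', Phi b b' = Phi b' b}.
  move=> b b' /inbs[s su ->] /inbs[t tu ->]; have [->//|st] := eqVneq s.1 t.1.
  have nu u : u \in unpaired be -> u.1 != a.
    by rewrite mem_filter => /andP[_ ub']; apply: notin_label aB _; rewrite !mem_cat ub' orbT.
  by apply: oppr_inj; rewrite -!kE // 1?eq_sym // kappa_sym ?nu.
have ubs : uniq bs by rewrite filter_uniq ?undup_uniq.
have PP : P = - \sum_(i < m) \sum_(j < m | (i < j)%N) Phi (nth 0%N bs i) (nth 0%N bs j).
  (* After doubling, both sides run over ordered pairs, so the order along the arc and the order of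
     [bs] no longer have to agree. *)
  apply: double_inj; rewrite PE -opprD -mulr2n -double_sum_ltn //.
  transitivity (\sum_(s <- unpaired be) \sum_(t <- unpaired be | t.1 != s.1) kappa H G Qp Qm a f0 L B s t).
    (* Oddness of [kappa] in each argument removes the chords with both ends on the arc, separately
       in the outer and the inner sum. *)
    rewrite -(sum_flip_odd (P := xpredT) (F := fun s => \sum_(t <- unpaired be | t.1 != s.1) kappa H G Qp Qm a f0 L B s t)) //.
      by apply: eq_bigr => s _; apply: sum_flip_odd => // t; rewrite kappa_flipr.
    by move=> s; rewrite -sumrN; apply: eq_bigr => t _; rewrite kappa_flipl.
  rewrite -(perm_big _ pb) /= big_map -sumrN big_seq [RHS]big_seq; apply: eq_bigr => s su.
  rewrite -(perm_big _ pb) /= big_map -sumrN big_seq_cond [RHS]big_seq_cond.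
  by apply: eq_bigr => t /andP[tu ts]; rewrite kE // eq_sym.
have SS : \sum_(t <- unpaired be) Ev H G Qp Qm f0 (rml t.1 L) (rmt t.1 B) =
    \sum_(i < m) W e0 (del D [:: a; nth 0%N bs i]).
  rewrite -(big_mkord xpredT (fun i => W e0 (del D [:: a; nth 0%N bs i]))) -(big_nth 0%N xpredT (fun b => W e0 (del D [:: a; b]))).
  rewrite -(perm_big _ pb) big_map; apply: eq_bigr => t _.
  by have := W_del2 H G Qp Qm vB aB t.1; rewrite -DE => ->.
have W1 : W e0 (del D [:: a]) = Ev H G Qp Qm f0 L B.
  by have := W_del1 H G Qp Qm vB aB; rewrite -DE.
rewrite WD E -/B SS PP W1 -addrA; congr (_ + _).
(* The factor [H * H] is -y, which gives the sign of the single sum; the minus sign in [PP] turns it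
   into +y for the double sum. *)
by rewrite /y !mulNr opprK -!mulrA mulrDr mulrN mulrDr mulrN.
Qed.
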